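(* Let $\{\omega_{\mathbf z}\}_{\mathbf z\in\mathbb Z^2}$ be i.i.d. exponential random variables with rate one, and let $\Gamma_{0,n}$ denote the (almost surely unique) geodesic from $(0,0)$ to $(n,n)$ in last-passage percolation with these weights. Then, with the limit along even integers $n$, $$-\lim_{n\to\infty}\frac1n\log\mathbb P\big((n,0)\in\Gamma_{0,n}\big)=2-2\log2.$$
   Context: Let $\mathbf e_1,\mathbf e_2$ be the standard basis vectors of $\mathbb R^2$. For coordinatewise-ordered points $\mathbf u\le\mathbf v$ in $\mathbb Z^2$, an up-right path from $\mathbf u$ to $\mathbf v$ is a finite sequence $\gamma=(\gamma_i)_{i=0}^{|\mathbf u-\mathbf v|_1}$ in $\mathbb Z^2$ with $\gamma_0=\mathbf u$, $\gamma_{|\mathbf u-\mathbf v|_1}=\mathbf v$ and $\gamma_{i+1}-\gamma_i\in\{\mathbf e_1,\mathbf e_2\}$. The last-passage value is $$G_{\mathbf u,\mathbf v}=\max_{\gamma:\mathbf u\to\mathbf v\text{ up-right}}\ \sum_{\mathbf z\in\gamma\setminus\{\mathbf u\}}\omega_{\mathbf z}.$$ The maximizing path is called the geodesic from $\mathbf u$ to $\mathbf v$. *)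

(* Defs.v *)
From HB Require Import structures.
From mathcomp Require Import all_boot all_order all_algebra.
From mathcomp Require Import all_classical all_reals all_analysis.

Set Implicit Arguments.
Unset Strict Implicit.
Unset Printing Implicit Defensive.

Import Order.TTheory GRing.Theory Num.Theory.
Import numFieldNormedType.Exports.

Local Open Scope classical_set_scope.
Local Open Scope ring_scope.

Definition site : Type := (int * int)%type.

Definition l1_dist (u v : site) : nat := (`|u.1 - v.1| + `|u.2 - v.2|)%N.

Definition e1 : site := (1, 0).
Definition e2 : site := (0, 1).

(* [g] lists all the vertices, endpoints included. There is no such path unless
   [u] is coordinatewise at most [v]. *)
Definition up_right_path (u v : site) (g : seq site) : Prop :=
  [/\ size g = (l1_dist u v).+1,
      nth u g 0 = u,
      nth u g (l1_dist u v) = v &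
      forall i, (i < l1_dist u v)%N ->
        nth u g i.+1 - nth u g i = e1 \/ nth u g i.+1 - nth u g i = e2].

Section last_passage.
Context {R : realType}.
Implicit Types (om : site -> R) (u v : site) (g : seq site).

(* An up-right path visits each of its sites once, so summing over the sequence
   is summing over the set of its vertices. *)
Definition passage_time om u g : R := \sum_(z <- g | z != u) om z.

Definition is_geodesic om u v g : Prop :=
  up_right_path u v g /\
  forall g', up_right_path u v g' -> passage_time om u g' <= passage_time om u g.

End last_passage.

Section random_environment.
Context {d : measure_display} {T : measurableType d} {R : realType}.
Variable P : probability T R.

Definition mutually_independent (I : choiceType) (X : I -> {RV P >-> R}) : Prop :=
  forall (s : seq I) (B : I -> set R),
    uniq s -> (forall i, measurable (B i)) ->
    P (\big[setI/setT]_(i <- s) (X i @^-1` B i)) =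
      (\prod_(i <- s) P (X i @^-1` B i))%E.

Definition iid_exponential (rate : R) (I : choiceType) (X : I -> {RV P >-> R}) :
    Prop :=
  mutually_independent X /\
  forall i (B : set R), measurable B ->
    distribution P (X i) B = exponential_prob rate B.

(* A version of the geodesic from [u] to [v]: a random path, measurable for the
   discrete sigma-algebra on the countable set of finite sequences of sites,
   which almost surely is a maximizing path. As the maximizer is almost surely
   unique, any two versions agree almost surely. *)
Definition geodesic_version (om : site -> {RV P >-> R}) (u v : site)
    (Gam : T -> seq site) : Prop :=
  (forall g, measurable [set w | Gam w = g]) /\
  {ae P, forall w, is_geodesic (fun z => om z w) u v (Gam w)}.

End random_environment.

(* Main.v *)
Require Import Defs.
From HB Require Import structures.
From mathcomp Require Import all_boot all_order all_algebra.
From mathcomp Require Import all_classical all_reals all_analysis.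
From mathcomp Require Import measurable_realfun.
From mathcomp Require Import ring lra zify.

Set Implicit Arguments.
Unset Strict Implicit.
Unset Printing Implicit Defensive.

Import Order.TTheory GRing.Theory Num.Theory.
Import numFieldNormedType.Exports.

Local Open Scope classical_set_scope.
Local Open Scope ring_scope.

(** The cost [2 - 2 ln 2] per unit length is the price of making the corner path,
    which runs along the bottom of the square and then up its right side, as good
    as the best path through the interior. A path through [(n, 0)] has to be the
    corner path. It collects [2n] independent exponential weights, so that its
    value is typically about [2n], whereas the last-passage value of the square is
    about [4n]. By the Chernoff bound and the explicit Erlang distribution, the
    sum of [2n] weights exceeds [4n] with probability
    [exp (- 2n (1 - ln 2) + o(n))]. Two things remain to be shown: that no
    cheaper scenario exists, and that this one suffices.

    That the bulk has speed 4 rests on the stationary model, in which the weights on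
    the two axes have rates [al] and [be] with [al + be = 1]. A local exchange of
    independent exponential variables at one vertex ([burke_step]), swept through
    the quadrant, shows that the increments of stationary passage times along a
    vertical line are independent exponential variables ([burke_vertical]).
    Stationary passage times are therefore sums of two Erlang variables. The path
    of the model with rates [1/2] leaves the axes near the origin, because the
    models with rates [1/2 - tau] and [1/2 + tau] bound its value otherwise
    ([exit_point]); removing the axes thus costs little, and the passage time of
    an [L] by [L] block is at least [(4 - eps) L] up to a small probability
    ([bulk_lln]).

    Upper bound ([corner_upper]). Either the corner path weighs at least
    [(4 - 4 eps) n], which has the right cost, or every path of the square weighs
    less. In the second case consider [2L] disjoint diagonal strips made of
    [L] by [L] blocks. In each of them a positive fraction of the blocks must be
    slow. Each block is slow with a tiny probability [p] and the blocks are
    independent, so choosing [p] small enough makes this less likely than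
    [exp (- n)] ([strips_unlikely]), while [2 - 2 ln 2 <= 1].

    Lower bound ([corner_lower]). Cut each side of the corner path into [q] blocks of
    length [b] close to [n / q], and let each of them have a sum at least [2b]; this has
    probability about [exp (- 2n (1 - ln 2))]. Let moreover the corner weight be of
    order [n / q], and let the passage times of a stationary model that contains
    the interior stay below their typical growth plus [n / q]. These events
    concern disjoint sets of sites, hence are independent. On their intersection
    an explicit potential shows that any path avoiding the corner is strictly
    worse than the corner path ([corner_wins]). The extra cost is [O(n / q)], and
    [q] is arbitrary. *)

(** * Families of independent exponential variables *)

Lemma measurable_ge d (T : measurableType d) (R : realType) (f : T -> R) y :
  measurable_fun setT f -> measurable [set t | y <= f t].
Proof.
move=> mf; rewrite -[X in measurable X]setTI.
rewrite (_ : [set t | _] = f @^-1` `[y, +oo[); first exact: mf.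
by apply/seteqP; split=> t /=; rewrite in_itv/= andbT.
Qed.

Lemma measurable_lt d (T : measurableType d) (R : realType) (f : T -> R) c :
  measurable_fun setT f -> measurable [set t | f t < c].
Proof.
move=> mf; rewrite (_ : [set t | f t < c] = ~` [set t | c <= f t]); last first.
  by apply/seteqP; split => t /=; [rewrite ltNge => /negP|move=> /negP; rewrite -ltNge].
by apply: measurableC; exact: measurable_ge.
Qed.

Section expo_family.
Context {d : measure_display} {T : measurableType d} {R : realType}.
Variable P : probability T R.

(** Both sides are finite measures in the first event, and finite measures that
    agree on a generating family stable under intersection are equal. *)
Lemma indep_generated (G : set (set T)) (B : set T) :
  G `<=` measurable -> setI_closed G -> G setT -> measurable B ->
  (forall A, G A -> P (A `&` B) = (P A * P B)%E) ->
  forall A, <<s G >> A -> P (A `&` B) = (P A * P B)%E.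
Proof.
move=> Gm GI GT mB h A sA.
have c0 : 0 <= fine (P B) by apply: fine_ge0.
pose c : {nonneg R} := NngNum c0.
have cE : (c%:num)%:E = P B by rewrite /= fineK// fin_num_measure.
have : mrestr P mB A = mscale c P A.
  apply: (@g_sigma_algebra_measure_unique _ _ _ G Gm (fun=> setT) (fun=> GT)).
  - by rewrite bigcup_const//; exists 0%N.
  - exact: GI.
  - move=> E GE; apply: etrans (h _ GE) _.
    by rewrite -cE muleC.
  - move=> _; rewrite -ge0_fin_numE ?measure_ge0//.
    by rewrite /mrestr fin_num_measure.
  - exact: sA.
by move=> e; apply: (etrans e); rewrite [LHS]/mscale cE muleC.
Qed.

Variable I : choiceType.
Implicit Types (X : I -> T -> R) (r x : I -> R) (A S : set I) (s : seq I).

Definition tails X s x : set T := [set t | forall i, i \in s -> x i <= X i t].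

(** The joint tail probabilities at nonnegative thresholds express at once that
    the variables indexed by [A] are independent and that the one of index [i] is
    exponential with rate [r i]. Variables outside [A] are only measurable and
    nonnegative, so that families can share an index type and be compared after
    local changes. *)
Definition expo_family A X r : Prop :=
  [/\ forall i, measurable_fun setT (X i),
      forall i t, 0 <= X i t,
      forall i, A i -> 0 < r i &
      forall s x, uniq s -> (forall i, i \in s -> A i) ->
        (forall i, 0 <= x i) ->
        P (tails X s x) = (expR (- \sum_(i <- s) r i * x i))%:E].

Definition gens X S : set (set T) :=
  [set E | exists i y, S i /\ E = [set t | y <= X i t]].

Definition sig X S : set (set T) := <<s gens X S >>.

(** For a nonnegative family, the generators of [sig X S] closed under
    intersection, with a known probability. *)
Definition rects X S : set (set T) :=
  [set E | exists s x, [/\ uniq s, forall i, i \in s -> S i,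
    forall i, 0 <= x i & E = tails X s x]].

Lemma tails_cons X i s x :
  tails X (i :: s) x = [set t | x i <= X i t] `&` tails X s x.
Proof.
apply/seteqP; split=> t /=.
  move=> h; split; first by apply: h; rewrite mem_head.
  by move=> j js; apply: h; rewrite inE js orbT.
by move=> [h1 h2] j; rewrite inE => /predU1P[->//|]; exact: h2.
Qed.

Lemma tails_nil X x : tails X [::] x = setT.
Proof. by apply/seteqP; split => t. Qed.

Lemma measurable_tails X s x : (forall i, measurable_fun setT (X i)) ->
  measurable (tails X s x).
Proof.
move=> mX; elim: s => [|i s ih]; first by rewrite tails_nil.
by rewrite tails_cons; apply: measurableI => //; exact: measurable_ge.
Qed.

Lemma sig_tail X S i y : S i -> sig X S [set t | y <= X i t].
Proof. by move=> Si; apply: sub_sigma_algebra; exists i, y. Qed.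

Lemma sig_sub X S S' : S `<=` S' -> sig X S `<=` sig X S'.
Proof.
move=> SS'; apply: smallest_sub; first exact: smallest_sigma_algebra.
by move=> E [i [y [Si ->]]]; apply: sig_tail; exact: SS'.
Qed.

Lemma sig_measurable X S : (forall i, measurable_fun setT (X i)) ->
  sig X S `<=` measurable.
Proof.
move=> mX; apply: smallest_sub; first exact: sigma_algebra_measurable.
by move=> E [i [y [Si ->]]]; exact: measurable_ge.
Qed.

Lemma sig_rects X S : (forall i t, 0 <= X i t) ->
  sig X S `<=` <<s rects X S >>.
Proof.
move=> X0; apply: smallest_sub; first exact: smallest_sigma_algebra.
move=> E [i [y [Si ->]]]; apply: sub_sigma_algebra.
exists [:: i], (fun=> Num.max 0 y); split => //.
- by move=> j; rewrite inE => /eqP ->.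
- by move=> j; rewrite le_max lexx.
- apply/seteqP; split=> t /=.
    by move=> h j; rewrite inE => /eqP ->; rewrite ge_max X0.
  by move=> /(_ i); rewrite inE eqxx => /(_ isT); rewrite ge_max => /andP[].
Qed.

Lemma rects_setI X S : (forall i t, 0 <= X i t) -> setI_closed (rects X S).
Proof.
move=> X0 _ _ [s [x [us sS x0 ->]]] [s' [x' [us' sS' x0' ->]]].
exists (undup (s ++ s')), (fun i => Num.max (if i \in s then x i else 0)
  (if i \in s' then x' i else 0)); split.
- exact: undup_uniq.
- by move=> i; rewrite mem_undup mem_cat => /orP[/sS|/sS'].
- by move=> i; rewrite le_max; case: ifP => _; rewrite ?x0 ?lexx.
- apply/seteqP; split=> t /=.
    move=> [h h'] i _; rewrite ge_max; apply/andP; split.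
      by case: ifPn => // /h.
    by case: ifPn => // /h'.
  move=> h; split=> i si; have := h i; rewrite mem_undup mem_cat si ?orbT/=;
    by rewrite ge_max => /(_ isT)/andP[].
Qed.

(** The product formula holds for two tail events over disjoint lists of
    indices, and extends from them to each generated sigma-algebra in turn. *)
Lemma sig_indep A X r S S' E E' : expo_family A X r ->
  S `<=` A -> S' `<=` A -> S `&` S' = set0 -> sig X S E -> sig X S' E' ->
  P (E `&` E') = (P E * P E')%E.
Proof.
move=> [mX X0 _ XP] SA SA' SS' sE sE'.
have rT S0 : rects X S0 setT.
  by exists [::], (fun=> 0); split => //; rewrite tails_nil.
have rm S0 : rects X S0 `<=` measurable.
  by move=> _ [s [x [_ _ _ ->]]]; exact: measurable_tails.
have step1 E0 E1 : rects X S E0 -> rects X S' E1 -> P (E0 `&` E1) = (P E0 * P E1)%E.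
  move=> [s [x [us sS x0 ->]]] [s' [x' [us' sS' x0' ->]]].
  have disj i : i \in s -> i \in s' -> False.
    by move=> /sS Si /sS' S'i; have : (S `&` S') i by []; rewrite SS'.
  pose z i := if i \in s then x i else x' i.
  have zs i : i \in s -> z i = x i by rewrite /z => ->.
  have zs' i : i \in s' -> z i = x' i.
    by move=> si; rewrite /z; case: ifPn => // /disj/(_ si).
  have -> : tails X s x `&` tails X s' x' = tails X (s ++ s') z.
    apply/seteqP; split=> t /=.
      move=> [h h'] i; rewrite mem_cat => /orP[si|si].
        by rewrite zs//; exact: h.
      by rewrite zs'//; exact: h'.
    move=> h; split=> i si; [rewrite -zs//|rewrite -zs'//]; apply: h;
      by rewrite mem_cat si ?orbT.
  rewrite !XP//.
  - rewrite -EFinM -expRD -opprD big_cat/=; congr (_%:E); congr (expR (- _)); congr (_ + _).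
    + by apply: eq_big_seq => i /zs ->.
    + by apply: eq_big_seq => i /zs' ->.
  - by move=> i /sS'/SA'.
  - by move=> i /sS/SA.
  - rewrite cat_uniq us us' andbT/=; apply/hasPn => i si'.
    by apply/negP => /disj /(_ si').
  - by move=> i; rewrite mem_cat => /orP[/sS/SA|/sS'/SA'].
  - by move=> i; rewrite /z; case: ifP.
have step2 E0 E1 : sig X S E0 -> rects X S' E1 -> P (E0 `&` E1) = (P E0 * P E1)%E.
  move=> sE0 rE1; apply: (indep_generated (rm S)).
  - exact: rects_setI.
  - exact: rT.
  - exact: rm rE1.
  - by move=> E2 rE2; exact: step1.
  - exact: sig_rects.
rewrite setIC [RHS]muleC; apply: (indep_generated (rm S')).
- exact: rects_setI.
- exact: rT.
- exact: sig_measurable sE.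
- by move=> E2 rE2; rewrite setIC muleC; exact: step2.
- exact: sig_rects.
Qed.

End expo_family.


(** * The exponential law *)

Section exponential_law.
Context {R : realType}.
Notation mu := lebesgue_measure.

(** The bundled measure behind [exponential_prob] is reached by unification only
    when the positivity of the rate is at hand; the existential makes it usable
    in rewriting. *)
Lemma expo_probability (r : R) : 0 < r ->
  exists nu : probability (measurableTypeR R) R,
    nu = exponential_prob r :> (set R -> \bar R).
Proof. by move=> r0; unshelve eexists (exponential_prob r : probability _ _). Qed.

Lemma expo_tail (r x : R) : 0 < r -> 0 <= x ->
  exponential_prob r `[x, +oo[ = (expR (- (r * x)))%:E.
Proof.
move=> r0 x0; have cexpNM : continuous (fun z : R^o => expR (- r * z)).
  move=> z; apply: continuous_comp; last exact: continuous_expR.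
  by apply: continuousM => //; apply: (@continuousN _ R^o); exact: cst_continuous.
rewrite /exponential_prob (@ge0_continuous_FTC2y _ _
  (fun x => - (expR (- r * x))) _ 0)//.
- by rewrite EFinN oppeK add0e mulNr.
- by move=> y _; apply: exponential_pdf_ge0; exact: ltW.
- apply: (@continuous_subspaceW R^o _ _ [set` `[0, +oo[%R]).
    by move=> y /=; rewrite !in_itv/= !andbT; exact: le_trans.
  exact: within_continuous_exponential_pdf.
- rewrite -oppr0; apply: cvgN.
  rewrite (_ : (fun x => expR (- r * x)) =
               (fun z => expR (- z)) \o (fun z => r * z)); last first.
    by apply: eq_fun => y; rewrite mulNr.
  apply: (@cvg_comp _ _ _ _ _ _ (pinfty_nbhs R)); last exact: cvgr_expR.
  exact: gt0_cvgMry.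
- by apply: cvgN; apply/cvg_at_right_filter; exact: cexpNM.
- move=> z; rewrite in_itv/= andbT => xz; apply: derive1_exponential_pdf.
  by rewrite in_itv/= andbT (le_lt_trans x0).
Qed.

Lemma expo_tail_lt0 (r x : R) : 0 < r -> x < 0 ->
  exponential_prob r `[x, +oo[ = 1%E.
Proof.
move=> r0 x0; apply/eqP; rewrite eq_le; apply/andP; split.
  exact: (@probability_le1 _ _ _ (exponential_prob r)).
have <- : exponential_prob r `[0, +oo[ = 1%E.
  by rewrite expo_tail// mulr0 oppr0 expR0.
apply: (@le_measure _ _ _ (exponential_prob r)); rewrite ?inE//.
by move=> y /=; rewrite !in_itv/= !andbT; apply: le_trans; exact: ltW.
Unshelve. all: exact: r0.
Qed.

(** Closed right half-lines generate the Borel sets and are stable under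
    intersection. The maximum covers thresholds on both sides of 0. *)
Lemma expo_unique (r : R) (m : {measure set (measurableTypeR R) -> \bar R}) :
  0 < r ->
  (forall x, m `[x, +oo[%classic = (expR (- (r * Num.max 0 x)))%:E) ->
  forall B, measurable B -> m B = exponential_prob r B.
Proof.
move=> r0 h B mB.
have [nu nuE] := expo_probability r0.
pose g (k : nat) : set R := `[- (k%:R : R), +oo[%classic.
pose G := RGenCInfty.G (R := R).
have mG : @measurable _ (measurableTypeR R) = <<s G >>.
  exact: RGenCInfty.measurableE.
have GI : setI_closed G.
  move=> _ _ [x ->] [y ->]; exists (Num.max x y); apply/seteqP; split => z /=;
    by rewrite !in_itv/= !andbT ge_max => /andP.
have Gg k : G (g k) by exists (- k%:R).
have gT : \bigcup_k g k = setT.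
  rewrite -subTset => x _; exists (Num.bound x) => //; rewrite /g/=.
  by rewrite in_itv/= andbT lerNl ltW// unstable.ltrNbound.
have mnu A : G A -> m A = nu A.
  move=> [x ->]; rewrite h nuE; case: (leP 0 x) => x0; first by rewrite expo_tail.
  by rewrite expo_tail_lt0// mulr0 oppr0 expR0.
have goo k : (m (g k) < +oo)%E by rewrite h ltry.
rewrite -nuE.
exact: (@measure_unique _ R (measurableTypeR R) G g mG GI Gg gT m nu mnu goo B mB).
Qed.

(** The density is the Radon-Nikodym derivative with respect to Lebesgue
    measure. *)
Lemma integral_expo (r : R) (f : R -> \bar R) (r0 : 0 < r) :
  (exponential_prob r).-integrable setT f ->
  (\int[exponential_prob r]_x f x =
   \int[mu]_x (f x * (exponential_pdf r x)%:E))%E.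
Proof.
have [nu nuE] := expo_probability r0.
rewrite -nuE => intf; have mf := measurable_int _ intf.
have mpdf A : measurable_fun A (EFin \o exponential_pdf r).
  apply: measurable_funTS; apply/measurable_EFinP.
  exact: measurable_exponential_pdf.
have dom : nu `<< mu.
  apply/null_content_dominatesP => A mA muA.
  by rewrite nuE /exponential_prob; apply: null_set_integral => //; exact: mpdf.
rewrite -(Radon_Nikodym_change_of_variables dom measurableT intf).
apply: ae_eq_integral => //; first exact: emeasurable_funM.
  by apply: emeasurable_funM => //; exact: mpdf.
apply: ae_eqe_mul2l.
rewrite Radon_NikodymE//.
case: cid => /= h [h1 h2 h3].
apply: integral_ae_eq; [exact: measurableT|exact: h2|exact: mpdf|].
by move=> E _ mE; rewrite -h3// nuE.
Qed.

End exponential_law.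


(** * Conditioning on one variable *)

Section conditioning.
Context {d : measure_display} {T : measurableType d} {R : realType}.
Variable P : probability T R.
Variable I : choiceType.
Implicit Types (X : I -> T -> R) (r x : I -> R) (A S : set I) (s : seq I).

Lemma expo_family1 A X r i y : expo_family P A X r -> A i -> 0 <= y ->
  P [set t | y <= X i t] = (expR (- (r i * y)))%:E.
Proof.
move=> [mX X0 r0 XP] Ai y0.
have := XP [:: i] (fun=> y); rewrite big_seq1/= => <- //.
  congr (P _); apply/seteqP; split=> t /=.
    by move=> h j; rewrite inE => /eqP ->.
  by apply; rewrite mem_head.
by move=> j; rewrite inE => /eqP ->.
Qed.

Lemma sig_measurable_fun X S i : S i ->
  measurable_fun (setT : set (g_sigma_algebraType (gens X S))) (X i).
Proof.
move=> Si; apply: (measurability (@RGenCInfty.G R)).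
  exact: RGenCInfty.measurableE.
move=> _ [_ [y ->] <-]; rewrite setTI.
rewrite (_ : X i @^-1` _ = [set t | y <= X i t]); first exact: sig_tail.
by apply/seteqP; split=> t /=; rewrite in_itv/= andbT.
Qed.

Lemma expo_family_law A X r i B : expo_family P A X r -> A i -> measurable B ->
  P (X i @^-1` B) = exponential_prob (r i) B.
Proof.
move=> eX Ai mB; have [mX X0 r0 XP] := eX.
pose mf := MeasurableFun.Pack
  (MeasurableFun.Class (isMeasurableFun.Build _ _ T (measurableTypeR R) _ (mX i))).
rewrite -(@expo_unique R (r i) (distribution P mf)) ?r0// => x.
rewrite /distribution /pushforward/=.
rewrite -(expo_family1 eX Ai) ?le_max ?lexx//; congr (P _).
by apply/seteqP; split=> t /=; rewrite in_itv/= andbT ge_max X0.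
Qed.

(** As [X i] is independent of [sig X S], the joint law of [X i] and the point [t],
    the latter seen through [sig X S], is a product measure. The lemma is
    Fubini's theorem for it. *)
Lemma expo_cond A X r i S
    (D : set (measurableTypeR R * g_sigma_algebraType (gens X S))) :
  expo_family P A X r -> A i -> S `<=` A -> ~ S i -> measurable D ->
  P [set t | D (X i t, t)] =
    (\int[lebesgue_measure]_y
       (P [set t | D (y, t)] * (exponential_pdf (r i) y)%:E))%E.
Proof.
move=> eX Ai SA nSi mD; have [mX X0 r0 XP] := eX.
have mid : measurable_fun setT (id : T -> g_sigma_algebraType (gens X S)).
  by move=> _ E mE; rewrite setTI; exact: sig_measurable mE.
pose g := MeasurableFun.Pack (MeasurableFun.Class (isMeasurableFun.Build _ _ _ _ _ mid)).
have mfg := @measurable_fun_pair _ _ _ T (measurableTypeR R)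
  (g_sigma_algebraType (gens X S)) _ _ (mX i) mid.
pose h := MeasurableFun.Pack (MeasurableFun.Class (isMeasurableFun.Build _ _ T
  (measurableTypeR R * g_sigma_algebraType (gens X S))%type _ mfg)).
have [nu nuE] := expo_probability (r0 _ Ai).
have e1 : (nu \x distribution P g)%E D = P [set t | D (X i t, t)].
  apply: (@product_measure_unique _ _ _ _ _ nu (distribution P g) (distribution P h)) => //.
  move=> B C mB mC; rewrite [X in (X * _)%E](_ : _ = P (X i @^-1` B)); last first.
    by rewrite (expo_family_law eX Ai mB) -nuE.
  apply: (@sig_indep _ _ _ P I A X r [set i] S) => //.
  - by move=> j ->.
  - by rewrite -subset0 => j [/= ->].
  - by rewrite -[X in sig _ _ X]setTI; exact: sig_measurable_fun.
rewrite -e1.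
have mD' : measurable_fun setT (fun y : measurableTypeR R => P (xsection D y)).
  exact: (@measurable_fun_xsection _ _ _ _ _ (distribution P g)).
transitivity (\int[exponential_prob (r i)]_y P (xsection D y))%E.
  by rewrite -nuE.
rewrite integral_expo ?r0//.
  apply: eq_integral => y _; congr (P _ * _)%E.
  by apply/seteqP; split=> t /=; rewrite /xsection/= inE.
rewrite -nuE; apply/integrableP; split => //.
apply: (@le_lt_trans _ _ (\int[nu]_y cst 1 y)%E).
  apply: ge0_le_integral => //=; first exact: measurableT_comp.
  move=> y _; rewrite gee0_abs//; apply: probability_le1.
  have := @measurable_xsection _ _ (measurableTypeR R)
    (g_sigma_algebraType (gens X S)) D y mD.
  exact: (@sig_measurable _ _ _ _ X S mX).
rewrite integral_cst// mul1e.
by apply: (le_lt_trans (probability_le1 nu measurableT)); rewrite ltry.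
Qed.

End conditioning.


(** * Burke's property at one vertex *)

Section exponential_integrals.
Context {R : realType}.
Notation mu := lebesgue_measure.

Lemma expo_itv (r a b : R) : 0 < r -> 0 <= a -> a <= b ->
  exponential_prob r `[a, b[ = (expR (- (r * a)) - expR (- (r * b)))%:E.
Proof.
move=> r0 a0 ab; have b0 := le_trans a0 ab.
have [nu nuE] := expo_probability r0.
have : nu `[a, +oo[%classic = (nu `[a, b[%classic + nu `[b, +oo[%classic)%E.
  rewrite -measureU//=.
    by congr (nu _); apply/seteqP; split=> x /=; rewrite !in_itv/= ?andbT;
      case: (ltP x b) => xb; rewrite ?andbT ?andbF; move=> h; [left|right| |];
      rewrite //; case: h => // h; rewrite ?h//; exact: le_trans xb.
  by rewrite -subset0 => x [/=]; rewrite !in_itv/= andbT => /andP[_ xb]; rewrite leNgt xb.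
rewrite nuE !expo_tail// => h.
have nuf : exponential_prob r `[a, b[ \is a fin_num.
  by rewrite -nuE fin_num_measure.
by rewrite EFinB h addeK.
Qed.

Lemma expo_laplace (r g : R) : 0 < r -> 0 <= g ->
  (\int[mu]_y ((expR (- (g * y)))%:E * (exponential_pdf r y)%:E) =
   (r / (r + g))%:E)%E.
Proof.
move=> r0 g0; have rg0 : 0 < r + g by rewrite ltr_wpDr.
transitivity (\int[mu]_y ((r / (r + g))%:E * (exponential_pdf (r + g) y)%:E))%E.
  apply: eq_integral => y _; rewrite -!EFinM; congr EFin.
  case: (leP 0 y) => y0; last by rewrite !lt0_exponential_pdf// !mulr0.
  rewrite !exponential_pdfE// [RHS]mulrA divfK ?gt_eqF// mulrCA -expRD; congr (_ * expR _).
  by ring.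
rewrite ge0_integralZl//.
- by rewrite integral_exponential_pdf// mule1.
- by apply/measurable_EFinP; exact: measurable_exponential_pdf.
- by move=> y _; rewrite lee_fin exponential_pdf_ge0// ltW.
- by rewrite lee_fin divr_ge0// ltW.
Qed.

End exponential_integrals.

Section burke.
Context {d : measure_display} {T : measurableType d} {R : realType}.
Variable P : probability T R.
Variable I : choiceType.
Implicit Types (X : I -> T -> R) (r x : I -> R) (A S : set I) (s : seq I).
Notation mu := lebesgue_measure.

(** Lack of memory: [X i] is the smaller of the two variables with probability
    [r i / (r i + r j)], and the excess of [X j] is then exponential with rate
    [r j]. *)
Lemma expo_gap A X r i j S C (s : R) : expo_family P A X r -> A i -> A j ->
  i != j -> S `<=` A -> ~ S i -> ~ S j -> sig X S C -> 0 <= s ->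
  P ([set t | X i t + s <= X j t] `&` C) =
    ((r i / (r i + r j) * expR (- (r j * s)))%:E * P C)%E.
Proof.
move=> eX Ai Aj ij SA nSi nSj sC s0; have [mX X0 r0 XP] := eX.
pose S' := S `|` [set j].
have SS' : S `<=` S' by left.
have mC : measurable C := sig_measurable mX sC.
have PC0 : 0 <= fine (P C) by apply: fine_ge0.
have PCE : P C = (fine (P C))%:E by rewrite fineK// fin_num_measure.
pose TS := g_sigma_algebraType (gens X S').
have mXj : measurable_fun (setT : set TS) (X j).
  by apply: sig_measurable_fun; right.
pose D : set (measurableTypeR R * TS) :=
  [set z | 0 <= X j z.2 - z.1 - s /\ C z.2].
have mD : measurable D.
  apply: measurableI; last first.
    rewrite -[X in measurable X]setTI; apply: measurable_snd => //.
    exact: sig_sub sC.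
  apply: measurable_ge; apply: measurable_funB => //.
  apply: measurable_funB; last exact: measurable_fst.
  by apply: (measurableT_comp mXj); exact: measurable_snd.
have -> : [set t | X i t + s <= X j t] `&` C = [set t | D (X i t, t)].
  apply/seteqP; split=> t [/= h Ct]; split=> //=; move: h; lra.
rewrite (expo_cond eX Ai _ _ mD); last 2 first.
- by move=> k [/SA//|->].
- by move=> [//|/= ij']; rewrite ij' eqxx in ij.
transitivity (\int[mu]_y ((expR (- (r j * s)) * fine (P C))%:E *
   ((expR (- (r j * y)))%:E * (exponential_pdf (r i) y)%:E)))%E.
  apply: eq_integral => y _.
  case: (leP 0 y) => y0; last by rewrite lt0_exponential_pdf// !mule0.
  rewrite muleA; congr (_ * _)%E.
  have -> : [set t | D (y, t)] = [set t | y + s <= X j t] `&` C.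
    apply/seteqP; split=> t [/= h Ct]; split=> //=; move: h; lra.
  rewrite (@sig_indep _ _ _ P I A X r [set j] S)//.
  - rewrite (expo_family1 eX Aj) ?addr_ge0// {1}PCE -!EFinM; congr EFin.
    rewrite mulrAC -expRD; congr (expR _ * _); ring.
  - by move=> k ->.
  - by rewrite -subset0 => k [/= ->].
  - exact: sig_tail.
rewrite ge0_integralZl//.
- rewrite expo_laplace ?r0// ?(ltW (r0 _ _))// {2}PCE -!EFinM; congr EFin; ring.
- apply: emeasurable_funM; apply/measurable_EFinP.
    by apply: measurableT_comp => //; apply: measurableT_comp.
  exact: measurable_exponential_pdf.
- by move=> y _; rewrite -EFinM lee_fin mulr_ge0 ?expR_ge0// exponential_pdf_ge0// ltW ?r0.
- by rewrite lee_fin mulr_ge0 ?expR_ge0.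
Qed.

(** Conditionally on [X k = y] the intersection of the two events is empty for
    [y < a], since one of the two maxima vanishes and [a <= b]; it is the gap event
    [X i + (b - y) <= X j] for [a <= y < b], and everything for [b <= y]. The
    integral over [y] then gives a product. *)
Lemma burke_le A X r i j k S C (a b : R) : expo_family P A X r ->
  A i -> A j -> A k -> i != j -> k != i -> k != j -> r k = r i + r j ->
  S `<=` A -> ~ S i -> ~ S j -> ~ S k -> sig X S C -> 0 <= a -> a <= b ->
  P ([set t | a <= X k t + Num.max 0 (X i t - X j t)] `&`
     [set t | b <= X k t + Num.max 0 (X j t - X i t)] `&` C) =
    ((expR (- (r i * a + r j * b)))%:E * P C)%E.
Proof.
move=> eX Ai Aj Ak ij ki kj rk SA nSi nSj nSk sC a0 ab; have [mX X0 r0 XP] := eX.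
have b0 := le_trans a0 ab.
have ri0 := r0 _ Ai; have rj0 := r0 _ Aj; have rk0 := r0 _ Ak.
pose S' := S `|` [set i; j].
have SS' : S `<=` S' by left.
have mC : measurable C := sig_measurable mX sC.
have [pc PCE] : exists pc, P C = pc%:E.
  by exists (fine (P C)); rewrite fineK// fin_num_measure.
have pc0 : 0 <= pc by rewrite -lee_fin -PCE.
pose TS := g_sigma_algebraType (gens X S').
have mXi : measurable_fun (setT : set TS) (X i).
  by apply: sig_measurable_fun; right; left.
have mXj : measurable_fun (setT : set TS) (X j).
  by apply: sig_measurable_fun; right; right.
pose D : set (measurableTypeR R * TS) :=
  [set z | a <= z.1 + Num.max 0 (X i z.2 - X j z.2)] `&`
  [set z | b <= z.1 + Num.max 0 (X j z.2 - X i z.2)] `&` [set z | C z.2].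
have mXi2 : measurable_fun (setT : set (measurableTypeR R * TS)) (fun z => X i z.2).
  by apply: (measurableT_comp mXi); exact: measurable_snd.
have mXj2 : measurable_fun (setT : set (measurableTypeR R * TS)) (fun z => X j z.2).
  by apply: (measurableT_comp mXj); exact: measurable_snd.
have mD : measurable D.
  apply: measurableI; last first.
    rewrite -[X in measurable X]setTI; apply: measurable_snd => //.
    exact: sig_sub sC.
  apply: measurableI; apply: measurable_ge; apply: measurable_funD => //;
    apply: measurable_maxr => //; exact: measurable_funB.
rewrite [X in P X](_ : _ = [set t | D (X k t, t)])//.
rewrite (expo_cond eX Ak _ _ mD); last 2 first.
- by move=> l [/SA//|[->|->]].
- by move=> [//|[/= kE|/= kE]]; [rewrite kE eqxx in ki|rewrite kE eqxx in kj].
transitivity (\int[mu]_y (pc%:E *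
   ((expR (- (r j * b)))%:E * (((EFin \o exponential_pdf (r i)) \_ `[a, b[) y)
    + ((EFin \o exponential_pdf (r k)) \_ `[b, +oo[) y)))%E.
  apply: eq_integral => y _.
  rewrite !patchE !mem_setE !in_itv/= andbT.
  case: (leP 0 y) => y0; last first.
    rewrite lt0_exponential_pdf// mule0 (lt_geF (lt_le_trans y0 a0)).
    by rewrite (lt_geF (lt_le_trans y0 b0))/= mule0 adde0 mule0.
  case: (ltP y b) => yb; last first.
    rewrite andbF mule0 add0e/= -PCE; congr (P _ * _)%E.
    apply/seteqP; split => t; first by move=> [].
    by move=> Ct; split => //; split => /=;
      [apply: (le_trans ab)|]; apply: (le_trans yb); rewrite lerDl le_max lexx.
  rewrite andbT adde0; case: (leP a y) => ay; last first.
    rewrite mule0 mule0 [X in P X](_ : _ = set0) ?measure0 ?mul0e//.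
    rewrite -subset0 => t [[/= h1 h2] _]; move: h1 h2.
    case: (leP 0 (X i t - X j t)) => h; case: (leP 0 (X j t - X i t)) => h'; lra.
  have -> : [set t | D (y, t)] = [set t | X i t + (b - y) <= X j t] `&` C.
    apply/seteqP; split=> t /=.
      move=> [[/= _ h2] Ct]; split => //; move: h2.
      by case: (leP 0 (X j t - X i t)) => h'; lra.
    move=> [h Ct]; split => //; split => /=.
      by case: (leP 0 (X i t - X j t)); lra.
    by rewrite -lerBlDl le_max; apply/orP; right; lra.
  rewrite (expo_gap eX Ai Aj ij SA nSi nSj sC); last by lra.
  rewrite PCE -!EFinM; congr EFin; rewrite !exponential_pdfE// rk.
  have e1 : expR (- (r j * (b - y))) * expR (- (r i + r j) * y) =
     expR (- (r j * b)) * expR (- r i * y).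
    by rewrite -!expRD; congr expR; ring.
  have rij0 : r i + r j != 0 by rewrite gt_eqF// addr_gt0.
  transitivity (pc * r i * (expR (- (r j * (b - y))) * expR (- (r i + r j) * y))).
    by field.
  by rewrite e1; ring.
have m1 (c : R) D' : measurable D' ->
    measurable_fun setT ((EFin \o exponential_pdf c) \_ D').
  move=> mD'; apply/(measurable_restrictT _ _).1 => //.
  apply: measurable_funTS; apply/measurable_EFinP; exact: measurable_exponential_pdf.
have p0 (c : R) D' y : 0 < c -> (0 <= ((EFin \o exponential_pdf c) \_ D') y)%E.
  move=> c0; rewrite patchE; case: ifP => // _.
  by rewrite lee_fin exponential_pdf_ge0// ltW.
have E0 (x : R) : (0 <= (expR x)%:E)%E by rewrite lee_fin expR_ge0.
rewrite ge0_integralZl//; first last.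
  by move=> y _; rewrite adde_ge0// ?p0// mule_ge0// p0.
  by apply: emeasurable_funD; [apply: measurable_funeM|]; exact: m1.
rewrite ge0_integralD//; first last.
  exact: m1.
  by move=> y _; exact: p0.
  by apply: measurable_funeM; exact: m1.
  by move=> y _; rewrite mule_ge0// p0.
rewrite ge0_integralZl//; first last.
  by move=> y _; exact: p0.
  exact: m1.
rewrite -!integral_mkcond.
have -> : (\int[mu]_(x in `[a, b[) (EFin \o exponential_pdf (r i)) x)%E =
   exponential_prob (r i) `[a, b[ by [].
have -> : (\int[mu]_(x in `[b, +oo[) (EFin \o exponential_pdf (r k)) x)%E =
   exponential_prob (r k) `[b, +oo[ by [].
rewrite expo_itv// expo_tail// PCE muleC; congr (_ * _)%E.
rewrite -EFinM -EFinD; congr EFin; rewrite mulrBr -!expRD rk.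
rewrite (_ : - (r j * b) + - (r i * b) = - ((r i + r j) * b)); last by ring.
by rewrite subrK; congr expR; ring.
Qed.

(** The minimum of [X i] and [X j] is exponential with rate [r i + r j] and
    independent of their difference. Replacing it by an independent variable
    [X k] of the same law changes neither the law of the pair nor its
    independence from the other variables. *)
Lemma burke A X r i j k S C (a b : R) : expo_family P A X r ->
  A i -> A j -> A k -> i != j -> k != i -> k != j -> r k = r i + r j ->
  S `<=` A -> ~ S i -> ~ S j -> ~ S k -> sig X S C -> 0 <= a -> 0 <= b ->
  P ([set t | a <= X k t + Num.max 0 (X i t - X j t)] `&`
     [set t | b <= X k t + Num.max 0 (X j t - X i t)] `&` C) =
    ((expR (- (r i * a + r j * b)))%:E * P C)%E.
Proof.
move=> eX Ai Aj Ak ij ki kj rk SA nSi nSj nSk sC a0 b0.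
have [ab|/ltW ba] := leP a b.
  exact: (burke_le eX Ai Aj Ak ij ki kj rk SA nSi nSj nSk sC a0 ab).
rewrite addrC [X in P (X `&` _)]setIC; rewrite addrC in rk; rewrite eq_sym in ij.
exact: (burke_le eX Aj Ai Ak ij kj ki rk SA nSj nSi nSk sC b0 ba).
Qed.

End burke.


(** * Operations on exponential families *)

Section family_operations.
Context {d : measure_display} {T : measurableType d} {R : realType}.
Variable P : probability T R.
Variable I : choiceType.
Implicit Types (X : I -> T -> R) (r x : I -> R) (A S : set I) (s : seq I).

Lemma tails_sig X S s x : (forall i, i \in s -> S i) -> sig X S (tails X s x).
Proof.
elim: s => [|i s ih] sS.
  by rewrite tails_nil; exact: (@measurableT _ (g_sigma_algebraType (gens X S))).
rewrite tails_cons.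
apply: (@measurableI _ (g_sigma_algebraType (gens X S))).
  by apply: sig_tail; apply: sS; rewrite mem_head.
by apply: ih => j js; apply: sS; rewrite inE js orbT.
Qed.

Lemma sum_split_two (F : I -> R) s i j : uniq s -> i != j ->
  \sum_(l <- s) F l = (if i \in s then F i else 0) + (if j \in s then F j else 0)
    + \sum_(l <- s | (l != i) && (l != j)) F l.
Proof.
move=> us ij; elim: s us => [|l s ih] /=; first by rewrite !big_nil !addr0.
move=> /andP[ls us]; rewrite !big_cons ih// !inE.
have [il|il] /= := eqVneq i l.
  by subst l; rewrite (negbTE ls) (eq_sym j) (negbTE ij)/= add0r addrA.
have [jl|jl] /= := eqVneq j l; last by ring.
by subst l; rewrite (negbTE ls); ring.
Qed.

(** One vertex of the stationary model: [X i] and [X j] are the increments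
    along the bottom and left edges of a cell, [X k] is the weight of its upper
    right vertex, and the new values are the increments along the top and right
    edges. The weight is used up. *)
Lemma burke_step A X r i j k : expo_family P A X r -> A i -> A j -> A k ->
  i != j -> k != i -> k != j -> r k = r i + r j ->
  expo_family P (A `\ k)
    (fun l t => if l == i then X k t + Num.max 0 (X i t - X j t)
                else if l == j then X k t + Num.max 0 (X j t - X i t)
                else X l t) r.
Proof.
move=> eX Ai Aj Ak ij ki kj rk; have [mX X0 r0 XP] := eX.
split.
- move=> l; case: eqP => _; first by apply: measurable_funD => //;
    apply: measurable_maxr => //; exact: measurable_funB.
  case: eqP => _ //; apply: measurable_funD => //;
    apply: measurable_maxr => //; exact: measurable_funB.
- move=> l t; case: eqP => _; first by rewrite addr_ge0// le_max lexx.
  by case: eqP => _ //; rewrite addr_ge0// le_max lexx.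
- by move=> l [/r0].
- move=> s x us sA x0.
pose s' := [seq l <- s | (l != i) && (l != j)].
pose a := if i \in s then x i else 0; pose b := if j \in s then x j else 0.
pose S : set I := A `&` [set l | [/\ l != i, l != j & l != k]].
have s'S l : l \in s' -> S l.
  rewrite mem_filter => /andP[/andP[li lj] /sA[Al /eqP lk]].
  by split => //; split => //.
rewrite [X in P X](_ : _ =
    [set t | a <= X k t + Num.max 0 (X i t - X j t)] `&`
    [set t | b <= X k t + Num.max 0 (X j t - X i t)] `&` tails X s' x); last first.
  apply/seteqP; split=> t.
    move=> h; split.
      split; rewrite /= /a /b; case: ifPn => [si|_]; rewrite ?addr_ge0 ?le_max ?lexx//.
        by have := h _ si; rewrite eqxx.
      by have := h _ si; rewrite eqxx eq_sym (negbTE ij).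
    move=> l; rewrite mem_filter => /andP[/andP[li lj]] /h.
    by rewrite (negbTE li) (negbTE lj).
  move=> [[/= ha hb] h] l ls; case: eqP => [lE|/eqP li].
    by rewrite lE; move: ha; rewrite /a -lE ls.
  case: eqP => [lE|/eqP lj]; first by rewrite lE; move: hb; rewrite /b -lE ls.
  by apply: h; rewrite mem_filter li lj.
rewrite (burke eX Ai Aj Ak ij ki kj rk (S := S)).
- rewrite XP.
  + rewrite -EFinM -expRD; congr (expR _)%:E.
    rewrite -opprD; congr (- _); rewrite (sum_split_two _ us ij) big_filter.
    by rewrite /a /b !(fun_if (fun z => _ * z)) !mulr0.
  + exact: filter_uniq.
  + by move=> l /s'S[].
  + exact: x0.
- by move=> l [].
- by move=> [_ [/eqP]].
- by move=> [_ [_ /eqP]].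
- by move=> [_ [_ _ /eqP]].
- exact: tails_sig.
- by rewrite /a; case: ifP.
- by rewrite /b; case: ifP.
Qed.

Lemma expo_family_sub A A' X X' r r' : expo_family P A X r -> A' `<=` A ->
  (forall i, measurable_fun setT (X' i)) -> (forall i t, 0 <= X' i t) ->
  (forall i, A' i -> X' i = X i) -> (forall i, A' i -> r' i = r i) ->
  expo_family P A' X' r'.
Proof.
move=> [mX X0 r0 XP] AA mX' X0' eqX eqr; split => //.
- by move=> i A'i; rewrite eqr//; apply/r0/AA.
- move=> s x us sA x0; rewrite (eq_big_seq (fun i => r i * x i)); last first.
    by move=> i /sA /eqr ->.
  rewrite -XP//; last by move=> i /sA/AA.
  by congr (P _); apply/seteqP; split=> t h i si; have := h i si;
    rewrite (eqX i (sA i si)).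
Qed.

Lemma expo_family_scale A X r (c : I -> R) : (forall i, 0 < c i) ->
  expo_family P A X r ->
  expo_family P A (fun i t => c i * X i t) (fun i => r i / c i).
Proof.
move=> c0 [mX X0 r0 XP]; split.
- by move=> i; exact: measurable_funM.
- by move=> i t; rewrite mulr_ge0// ltW.
- by move=> i Ai; rewrite divr_gt0// r0.
- move=> s x us sA x0.
  transitivity (P (tails X s (fun i => x i / c i))).
    by congr (P _); apply/seteqP; split=> t h i si; have := h i si;
      rewrite ler_pdivrMr// mulrC.
  rewrite XP//; last by move=> i; rewrite divr_ge0// ltW.
  by congr (expR (- _))%:E; apply: eq_bigr => i _; rewrite mulrAC mulrA.
Qed.

End family_operations.


(** * Sums of exponential variables *)

Section erlang.
Context {R : realType}.
Notation mu := lebesgue_measure.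

Definition expsum (m : nat) (z : R) : R := \sum_(k < m) z ^+ k / k`!%:R.

Lemma expsumS m z : expsum m.+1 z = expsum m z + z ^+ m / m`!%:R.
Proof. by rewrite /expsum big_ord_recr. Qed.

Lemma expsum_ge0 m z : 0 <= z -> 0 <= expsum m z.
Proof. by move=> z0; apply: sumr_ge0 => k _; rewrite divr_ge0// exprn_ge0. Qed.

Lemma expsumS0 m : expsum m.+1 0 = 1.
Proof.
rewrite /expsum big_ord_recl/= expr0 fact0 divr1 big1 ?addr0// => k _.
by rewrite expr0n/= mul0r.
Qed.

Lemma is_derive_expsum (m : nat) (z : R) :
  is_derive z 1 (expsum m.+1) (expsum m z).
Proof.
elim: m => [|m ih].
  rewrite (_ : expsum 1 = cst 1); last first.
    by apply/funext => y; rewrite /expsum big_ord1 expr0 fact0 divr1.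
  by rewrite /expsum big_ord0; exact: is_derive_cst.
rewrite (_ : expsum m.+2 =
    expsum m.+1 + ((m.+1)`!%:R^-1 : R) *: ((@id R) ^+ m.+1)); last first.
  apply/funext => y /=; rewrite expsumS !fctE mulrC.
  by [].
rewrite expsumS; apply: is_deriveD.
apply: is_derive_eq.
rewrite factS natrM /GRing.scale/= mulr1; field.
by rewrite -mulrS !pnatr_eq0 -lt0n fact_gt0.
Qed.

Lemma continuous_expsum m : continuous (expsum m).
Proof.
case: m => [|m] z.
  rewrite (_ : expsum 0 = cst 0); first exact: cst_continuous.
  by apply/funext => y; rewrite /expsum big_ord0.
apply/differentiable_continuous/derivable1_diffP.
by have [] := is_derive_expsum m z.
Qed.

Lemma integral_expsum m (x : R) : 0 < x ->
  (\int[mu]_(y in `[0%R, x]) (expsum m (x - y))%:E = (expsum m.+1 x - 1)%:E)%E.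
Proof.
move=> x0.
have dF (y : R) : is_derive y 1 (fun y => - expsum m.+1 (x - y)) (expsum m (x - y)).
  have h2 : is_derive y 1 (fun y : R => x - y) (-1).
    by apply: is_derive_eq; rewrite add0r mul1r.
  have := is_deriveN (@is_derive1_comp _ (expsum m.+1) (fun y : R => x - y)
    y _ _ (is_derive_expsum m (x - y)) h2).
  by rewrite mulrN1 opprK.
have cF : continuous (fun y => - expsum m.+1 (x - y)).
  by move=> y; apply/differentiable_continuous/derivable1_diffP; have [] := dF y.
rewrite (@continuous_FTC2 _ _ (fun y => - expsum m.+1 (x - y)))//.
- by rewrite subrr subr0 expsumS0 -EFinB; congr EFin; ring.
- apply: continuous_subspaceT => y; apply: continuous_comp.
    by apply: (@continuousB _ R^o); [exact: cst_continuous|].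
  exact: continuous_expsum.
- split.
  + by move=> y _; have [] := dF y.
  + by apply: cvg_at_right_filter; exact: cF.
  + by apply: cvg_at_left_filter; exact: cF.
- by move=> y _; rewrite derive1E; have [] := dF y.
Qed.

End erlang.

Lemma sig_measurable_sum d (T : measurableType d) (R : realType) (I : choiceType)
    (X : I -> T -> R) (S : set I) (s : seq I) : (forall i, i \in s -> S i) ->
  measurable_fun (setT : set (g_sigma_algebraType (gens X S)))
    (fun t => \sum_(i <- s) X i t).
Proof.
elim: s => [|j l ihl] lS.
  by under eq_fun do rewrite big_nil; exact: measurable_cst.
under eq_fun do rewrite big_cons; apply: measurable_funD.
  by apply: sig_measurable_fun; apply: lS; rewrite mem_head.
by apply: ihl => k kl; apply: lS; rewrite inE kl orbT.
Qed.

Section erlang_tail.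
Context {d : measure_display} {T : measurableType d} {R : realType}.
Variable P : probability T R.
Variable I : choiceType.
Implicit Types (X : I -> T -> R) (r x : I -> R) (A S : set I) (s : seq I).
Notation mu := lebesgue_measure.

(** Induction on the list, conditioning on its first variable: the derivative of
    a truncated exponential series is the series truncated one term earlier. *)
Lemma erlang_tail A X s (x : R) : expo_family P A X (fun=> 1) ->
  uniq s -> (forall i, i \in s -> A i) -> 0 < x ->
  P [set t | x <= \sum_(i <- s) X i t] = (expR (- x) * expsum (size s) x)%:E.
Proof.
move=> eX; have [mX X0 r0 XP] := eX.
elim: s x => [|i s ih] x.
  move=> _ _ x0; rewrite /expsum big_ord0 mulr0 [X in P X](_ : _ = set0) ?measure0//.
  by rewrite -subset0 => t /=; rewrite big_nil leNgt x0.
move=> /= /andP[si us] sA x0.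
have Ai : A i by apply: sA; rewrite mem_head.
have sA' j : j \in s -> A j by move=> js; apply: sA; rewrite inE js orbT.
pose S : set I := [set j | j \in s].
pose TS := g_sigma_algebraType (gens X S).
have mS : measurable_fun (setT : set TS) (fun t => \sum_(i <- s) X i t).
  exact: sig_measurable_sum.
pose D : set (measurableTypeR R * TS) := [set z | x <= z.1 + \sum_(i <- s) X i z.2].
have mD : measurable D.
  apply: measurable_ge; apply: measurable_funD; first exact: measurable_fst.
  by apply: (measurableT_comp mS); exact: measurable_snd.
rewrite [X in P X](_ : _ = [set t | D (X i t, t)]); last first.
  by apply/seteqP; split => t /=; rewrite big_cons.
rewrite (expo_cond eX Ai _ _ mD); last 2 first.
- by move=> j; exact: sA'.
- exact/negP.
transitivity (\int[mu]_y ((expR (- x))%:E *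
     ((fun y => (expsum (size s) (x - y))%:E) \_ `[0%R, x[) y
     + ((EFin \o exponential_pdf 1) \_ `[x, +oo[) y))%E.
  apply: eq_integral => y _; rewrite !patchE !mem_setE !in_itv/= andbT.
  case: (leP 0 y) => y0; last first.
    by rewrite lt0_exponential_pdf// mule0 (lt_geF (lt_trans y0 x0))/= mule0 adde0.
  have Dle : x <= y -> P [set t | D (y, t)] = 1%E.
    move=> xy; rewrite [X in P X](_ : _ = setT) ?probability_setT//.
    rewrite -subTset => t _; apply: (le_trans xy); rewrite /= lerDl.
    by rewrite sumr_ge0.
  case: (leP x y) => xy /=.
    by rewrite mule0 add0e Dle ?mul1e.
  rewrite adde0 [X in P X](_ : _ = [set t | x - y <= \sum_(i <- s) X i t]); last first.
    by apply/seteqP; split => t /=; rewrite lerBlDl.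
  rewrite ih// ?subr_gt0// exponential_pdfE// -!EFinM; congr EFin.
  rewrite mul1r mulN1r mulrAC -expRD; congr (expR _ * _); ring.
have mexp : measurable_fun setT (fun y : R => (expsum (size s) (x - y))%:E).
  apply/measurable_EFinP; apply: continuous_measurable_fun => y.
  apply: continuous_comp; last exact: continuous_expsum.
  by apply: (@continuousB _ R^o); [exact: cst_continuous|].
have mE : measurable_fun setT ((fun y => (expsum (size s) (x - y))%:E) \_ `[0%R, x[).
  by apply/(measurable_restrictT _ _).1 => //; exact: measurable_funTS.
have mp : measurable_fun setT ((EFin \o exponential_pdf 1) \_ `[x, +oo[).
  apply/(measurable_restrictT _ _).1 => //.
  apply: measurable_funTS; apply/measurable_EFinP; exact: measurable_exponential_pdf.
have E0 y : (0 <= ((fun y => (expsum (size s) (x - y))%:E) \_ `[0%R, x[) y)%E.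
  rewrite patchE; case: ifPn => //; rewrite inE/= in_itv/= => /andP[_ yx].
  by rewrite lee_fin expsum_ge0// subr_ge0 ltW.
have p0 y : (0 <= ((EFin \o exponential_pdf 1) \_ `[x, +oo[) y)%E.
  by rewrite patchE; case: ifPn => // _; rewrite lee_fin exponential_pdf_ge0.
have ex0 : (0 <= (expR (- x))%:E)%E by rewrite lee_fin expR_ge0.
rewrite ge0_integralD//; first last.
  by apply: measurable_funeM.
  by move=> y _; rewrite mule_ge0.
rewrite ge0_integralZl//.
rewrite -!integral_mkcond integral_itv_bndo_bndc; last first.
  exact: measurable_funTS.
rewrite integral_expsum//.
have -> : (\int[mu]_(y in `[x, +oo[) (EFin \o exponential_pdf 1) y)%E =
   exponential_prob 1 `[x, +oo[ by [].
rewrite expo_tail//; last exact: ltW.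
by rewrite -EFinM -EFinD; congr EFin; rewrite mul1r; ring.
Qed.

End erlang_tail.


Section exponential_sums.
Context {R : realType}.

Lemma cvg_expsum (z : R) : expsum N z @[N --> \oo] --> expR z.
Proof.
rewrite (_ : (fun N => expsum N z) = series (exp_coeff z)).
  exact: is_cvg_series_exp_coeff.
by apply/funext => N; rewrite /series/= /expsum big_mkord.
Qed.

Lemma expsum_le_expR m (z : R) : 0 <= z -> expsum m z <= expR z.
Proof.
move=> z0; rewrite -(cvg_lim _ (cvg_expsum (z:=z)))//.
apply: (nondecreasing_cvgn_le (u_ := fun N => expsum N z)).
  apply/nondecreasing_seqP => N; rewrite expsumS lerDl.
  by rewrite divr_ge0// exprn_ge0.
by apply/cvg_ex; exists (expR z); exact: cvg_expsum.
Qed.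

(** Each term of index [k < m] satisfies [x ^ k <= t ^- m (t x) ^ k] when
    [t <= 1]. With [erlang_tail] this is the Chernoff bound for the upper tail. *)
Lemma expsum_le m (t x : R) : 0 < t <= 1 -> 0 <= x ->
  expsum m x <= t ^- m * expR (t * x).
Proof.
move=> /andP[t0 t1] x0.
rewrite -ler_pdivrMl ?invr_gt0 ?exprn_gt0// invrK.
apply: le_trans (expsum_le_expR m (mulr_ge0 (ltW t0) x0)).
rewrite /expsum mulr_sumr; apply: ler_sum => k _.
rewrite exprMn mulrA ler_wpM2r ?invr_ge0// ler_wpM2r ?exprn_ge0//.
by rewrite ler_wiXn2l ?(ltW t0)// ltnW.
Qed.

(** The same comparison for the remainder of the series, where [m <= k] and
    [1 <= t]; it gives the Chernoff bound for the lower tail. *)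
Lemma expR_sub_expsum_le m (t x : R) : 1 <= t -> 0 <= x ->
  expR x - expsum m x <= t ^- m * expR (t * x).
Proof.
move=> t1 x0; have t0 : 0 < t by exact: lt_le_trans t1.
have key N : expsum (m + N) x - expsum m x <= t ^- m * expR (t * x).
  rewrite -ler_pdivrMl ?invr_gt0 ?exprn_gt0// invrK.
  apply: le_trans (expsum_le_expR (m + N) (mulr_ge0 (ltW t0) x0)).
  have spl (z : R) : expsum (m + N) z =
    expsum m z + \sum_(k < N) z ^+ (m + k) / (m + k)`!%:R.
    by rewrite /expsum big_split_ord.
  rewrite !spl addrC addKr mulr_sumr -[leLHS]add0r lerD//.
    by apply: sumr_ge0 => k _; rewrite divr_ge0// exprn_ge0// mulr_ge0// ltW.
  apply: ler_sum => k _; rewrite exprMn mulrA ler_wpM2r ?invr_ge0//.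
  by rewrite ler_wpM2r ?exprn_ge0// ler_weXn2l// leq_addr.
rewrite lerBlDr -(cvg_lim _ (cvg_expsum (z:=x)))//; apply: limr_le.
  by apply/cvg_ex; exists (expR x); exact: cvg_expsum.
by exists m => // N /= mN; rewrite -(subnKC mN) -lerBlDr.
Qed.

(** A weak form of Stirling's formula, losing a factor [sqrt n]. The induction
    step is [e <= (1 + 1/n) ^ (n + 1)]. *)
Lemma fact_le (n : nat) : (n.+1)`!%:R <= expR 1 * n.+1%:R * (n.+1%:R / expR 1) ^+ n.+1 :> R.
Proof.
elim: n => [|n ih]; first by rewrite expr1 mulr1 mul1r divff// gt_eqF// expR_gt0.
rewrite factS natrM; apply: (le_trans (ler_wpM2l (ler0n _ _) ih)).
have e0 : 0 < expR 1 :> R by exact: expR_gt0.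
have n0 : 0 < n.+1%:R :> R by rewrite ltr0n.
have h : n.+1%:R ^+ n.+2 * expR 1 <= n.+2%:R ^+ n.+2 :> R.
  have h1 : n.+1%:R / n.+2%:R <= expR (- (n.+2%:R)^-1) :> R.
    apply: le_trans (expR_ge1Dx _); rewrite le_eqVlt; apply/orP; left; apply/eqP.
    by rewrite -[n.+2]addn1 natrD; field; apply: lt0r_neq0; have := ler0n R n; lra.
  rewrite -ler_pdivlMr// -expRN.
  have -> : expR (- 1) = expR (- (n.+2%:R)^-1) ^+ n.+2 :> R.
    by rewrite -expRM_natr mulNr mulVf// pnatr_eq0.
  rewrite mulrC -ler_pdivrMr ?exprn_gt0// -expr_div_n lerXn2r ?nnegrE ?divr_ge0// ?expR_ge0//.
have -> : n.+2%:R * (expR 1 * n.+1%:R * (n.+1%:R / expR 1) ^+ n.+1) =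
    expR 1 * n.+2%:R / expR 1 ^+ n.+2 * (n.+1%:R ^+ n.+2 * expR 1) :> R.
  rewrite expr_div_n (exprS (n.+1%:R : R) n.+1) (exprS (expR 1) n.+1).
  have := expf_neq0 n.+1 (lt0r_neq0 e0); have := lt0r_neq0 e0.
  move: (expR 1 : R) (n.+1%:R : R) (n.+2%:R : R) => e a c e1 E1; field.
  by rewrite e1 E1.
rewrite expr_div_n (mulrC (n.+2%:R ^+ n.+2) _^-1) [leRHS]mulrA ler_wpM2l//.
Qed.

End exponential_sums.

Section erlang_bounds.
Context {d : measure_display} {T : measurableType d} {R : realType}.
Variable P : probability T R.
Variable I : choiceType.
Implicit Types (X : I -> T -> R) (r x : I -> R) (A S : set I) (s : seq I).

Lemma measurable_sumX X s : (forall i, measurable_fun setT (X i)) ->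
  measurable_fun setT (fun t => \sum_(i <- s) X i t).
Proof.
move=> mX; elim: s => [|j l ihl].
  by under eq_fun do rewrite big_nil; exact: measurable_cst.
by under eq_fun do rewrite big_cons; exact: measurable_funD.
Qed.

Lemma erlang_ge A X s (t x : R) : expo_family P A X (fun=> 1) ->
  uniq s -> (forall i, i \in s -> A i) -> 0 < t <= 1 -> 0 <= x ->
  (P [set w | (x <= \sum_(i <- s) X i w)%R] <=
   (t ^- size s * expR (- ((1 - t) * x)))%:E)%E.
Proof.
move=> eX us sA tt; have [mX X0 r0 XP] := eX.
rewrite le_eqVlt => /predU1P[<-|x0].
  rewrite mulr0 oppr0 expR0 mulr1; apply: (@le_trans _ _ 1%E).
    by apply: probability_le1; apply: measurable_ge; exact: measurable_sumX.
  have /andP[t0 t1] := tt.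
  by rewrite lee_fin -exprVn exprn_ege1// invf_ge1.
rewrite (erlang_tail eX us sA x0) lee_fin.
apply: (le_trans (ler_wpM2l (expR_ge0 _) (expsum_le _ tt (ltW x0)))).
by rewrite mulrCA -expRD le_eqVlt; apply/orP; left; apply/eqP; congr (_ * expR _); ring.
Qed.

Lemma erlang_lt A X s (t x : R) : expo_family P A X (fun=> 1) ->
  uniq s -> (forall i, i \in s -> A i) -> 1 <= t -> 
  (P [set w | (\sum_(i <- s) X i w < x)%R] <=
   (t ^- size s * expR ((t - 1) * x))%:E)%E.
Proof.
move=> eX us sA t1; have [mX X0 r0 XP] := eX.
have [x0|x0] := leP x 0.
  rewrite [X in P X](_ : _ = set0); first by
    rewrite measure0 lee_fin mulr_ge0 ?expR_ge0// invr_ge0 exprn_ge0// (le_trans _ t1).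
  rewrite -subset0 => w /=; rewrite ltNge => /negP; apply; apply: (le_trans x0).
  exact: sumr_ge0.
rewrite [X in P X](_ : _ = ~` [set w | x <= \sum_(i <- s) X i w]); last first.
  by apply/seteqP; split => w /=; [rewrite ltNge => /negP|move=> /negP; rewrite -ltNge].
rewrite probability_setC; last by apply: measurable_ge; exact: measurable_sumX.
rewrite (erlang_tail eX us sA x0) -EFinB lee_fin.
have -> : 1 - expR (- x) * expsum (size s) x = expR (- x) * (expR x - expsum (size s) x).
  by rewrite mulrBr -expRD addNr expR0.
apply: (le_trans (ler_wpM2l (expR_ge0 _) (expR_sub_expsum_le _ t1 (ltW x0)))).
by rewrite mulrCA -expRD le_eqVlt; apply/orP; left; apply/eqP; congr (_ * expR _); ring.
Qed.

End erlang_bounds.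


(** * Last passage in the quadrant and the stationary model *)

Section last_passage_recursion.
Context {R : realType}.
Implicit Types (w : nat -> nat -> R) (x y : nat).

(** The last-passage value from the origin of the quadrant, defined by its
    recursion; the weight of the origin is not counted. *)
Fixpoint lpp w x : nat -> R :=
  match x with
  | 0 => fix col y := if y is y'.+1 then col y' + w 0%N y else 0
  | x'.+1 => fix col y := if y is y'.+1 then w x y + Num.max (lpp w x' y) (col y')
                          else lpp w x' 0%N + w x 0%N
  end.

Lemma lpp00 w : lpp w 0 0 = 0. Proof. by []. Qed.

Lemma lpp0S w y : lpp w 0 y.+1 = lpp w 0 y + w 0%N y.+1. Proof. by []. Qed.

Lemma lppS0 w x : lpp w x.+1 0 = lpp w x 0 + w x.+1 0%N. Proof. by []. Qed.

Lemma lppSS w x y :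
  lpp w x.+1 y.+1 = w x.+1 y.+1 + Num.max (lpp w x y.+1) (lpp w x.+1 y).
Proof. by []. Qed.

Lemma lpp_ler w x y : (forall a b, 0 <= w a b) -> lpp w x y <= lpp w x y.+1.
Proof.
move=> w0; case: x => [|x]; first by rewrite lpp0S lerDl.
by rewrite lppSS (le_trans (y := Num.max (lpp w x y.+1) (lpp w x.+1 y)))
  ?le_max ?lexx ?orbT// lerDr.
Qed.

Lemma lpp_lel w x y : (forall a b, 0 <= w a b) -> lpp w x y <= lpp w x.+1 y.
Proof.
move=> w0; case: y => [|y]; first by rewrite lppS0 lerDl.
by rewrite lppSS (le_trans (y := Num.max (lpp w x y.+1) (lpp w x.+1 y)))
  ?le_max ?lexx// lerDr.
Qed.

(** Comparison principle: anything that dominates the values on the axes and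
    satisfies the recursion as an inequality dominates the passage times. It
    replaces any discussion of maximizing paths in the quadrant. *)
Lemma lpp_supersolution w (F : nat -> nat -> R) :
  (forall x, lpp w x 0 <= F x 0%N) -> (forall y, lpp w 0 y <= F 0%N y) ->
  (forall x y, w x.+1 y.+1 + Num.max (F x y.+1) (F x.+1 y) <= F x.+1 y.+1) ->
  forall x y, lpp w x y <= F x y.
Proof.
move=> Fx0 F0y Fxy; elim=> [|x ihx] //; elim=> [|y ihy] //.
rewrite lppSS; apply: le_trans (Fxy x y); rewrite lerD2l ge_max.
by rewrite !le_max ihx ihy orbT.
Qed.

End last_passage_recursion.
Arguments lpp : simpl never.

Section burke_lpp.
Context {d : measure_display} {T : measurableType d} {R : realType}.
Variable P : probability T R.
Implicit Types (X : nat * nat -> T -> R).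

Definition field X (t : T) (a b : nat) : R := X (a, b) t.

Definition stationary_rate (al be : R) (z : nat * nat) : R :=
  if z.1 == 0%N then be else if z.2 == 0%N then al else 1.

Definition vertical_increment X x b t : R := lpp (field X t) x b - lpp (field X t) x b.-1.

Lemma measurable_lpp d' (T' : measurableType d') (X : nat * nat -> T' -> R) x y :
  (forall a b, (a <= x)%N -> (b <= y)%N -> (a, b) != (0, 0)%N ->
     measurable_fun setT (X (a, b))) ->
  measurable_fun setT (fun t => lpp (fun a b => X (a, b) t) x y).
Proof.
elim: x y => [|x ihx]; elim=> [|y ihy] mX.
- exact: measurable_cst.
- under eq_fun do rewrite lpp0S; apply: measurable_funD; last exact: mX.
  by apply: ihy => a b ax bly; apply: mX => //; exact: leqW.
- under eq_fun do rewrite lppS0; apply: measurable_funD; last exact: mX.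
  by apply: ihx => a b ax bly; apply: mX => //; exact: leqW.
- under eq_fun do rewrite lppSS; apply: measurable_funD; first exact: mX.
  apply: measurable_maxr.
    by apply: ihx => a b ax bly; apply: mX => //; exact: leqW.
  by apply: ihy => a b ax bly; apply: mX => //; exact: leqW.
Qed.

Section sweep.
Variables (X : nat * nat -> T -> R) (al be : R) (n : nat).
Hypothesis mX : forall z, measurable_fun setT (X z).
Hypothesis X0 : forall z t, 0 <= X z t.
Hypothesis albe : al + be = 1.

Let w t a b := X (a, b) t.

(** Along a down-right staircase the increments of passage times form, together
    with the weights beyond the staircase, an independent family. The staircase
    follows the column [x.+1] up to height [y], steps left, and follows the
    column [x] above. The increment along the edge from height [b.-1] to [b] is
    stored at the index [(0, b)], and that of the step at height [y] at
    [(x.+1, 0)], so that one choice of rates fits all staircases. *)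
Definition sweep_field x y (z : nat * nat) (t : T) : R :=
  if z.1 == 0%N then
    (if z.2 == 0%N then 0 else
       vertical_increment X (if (z.2 <= y)%N then x.+1 else x) z.2 t)
  else if z == (x.+1, 0)%N then lpp (w t) x.+1 y - lpp (w t) x y
  else X z t.

(** The increments of the staircase up to height [n], and the weights beyond it
    in the rows up to [n]. *)
Definition sweep_active x y : set (nat * nat) := [set z |
  [|| [&& z.1 == 0, 0 < z.2 & z.2 <= n], (z.2 == 0) && (x < z.1),
      [&& 0 < z.2, z.2 <= n & x.+1 < z.1] |
      [&& z.1 == x.+1, y < z.2 & z.2 <= n]]%N].

Lemma measurable_sweep_field x y z : measurable_fun setT (sweep_field x y z).
Proof.
have ml a b : measurable_fun setT (fun t => lpp (w t) a b).
  by apply: (@measurable_lpp _ _ X).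
rewrite /sweep_field; case: (z.1 == 0%N).
  by case: (z.2 == 0%N); [exact: measurable_cst|apply: measurable_funB; exact: ml].
by case: (z == _); [apply: measurable_funB; exact: ml|exact: mX].
Qed.

Lemma sweep_field_ge0 x y z t : 0 <= sweep_field x y z t.
Proof.
rewrite /sweep_field; case: ifP => _.
  case: eqP => // /eqP; rewrite -lt0n => z0; rewrite subr_ge0.
  by case: (z.2) z0 => // b _; rewrite lpp_ler// => a c; exact: X0.
by case: ifP => _ //; rewrite subr_ge0 lpp_lel// => a c; exact: X0.
Qed.

(** Moving the staircase across the vertex [(x.+1, y.+1)] is an instance of
    [burke_step], because [al + be = 1]. *)
Lemma sweep_step x y : (y < n)%N ->
  expo_family P (sweep_active x y) (sweep_field x y) (stationary_rate al be) ->
  expo_family P (sweep_active x y.+1) (sweep_field x y.+1) (stationary_rate al be).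
Proof.
move=> yn eX.
have ai : sweep_active x y (x.+1, 0%N) by rewrite /sweep_active/=; lia.
have aj : sweep_active x y (0%N, y.+1) by rewrite /sweep_active/=; lia.
have ak : sweep_active x y (x.+1, y.+1) by rewrite /sweep_active/=; lia.
have ki : (x.+1, y.+1) != (x.+1, 0%N) by rewrite xpair_eqE andbF.
have eX' := burke_step eX ai aj ak isT ki isT (esym albe).
have fk t : sweep_field x y (x.+1, y.+1) t = X (x.+1, y.+1) t.
  by rewrite /sweep_field/= xpair_eqE andbF.
have fi t : sweep_field x y (x.+1, 0%N) t = lpp (w t) x.+1 y - lpp (w t) x y.
  by rewrite /sweep_field/= eqxx.
have fj t : sweep_field x y (0%N, y.+1) t = lpp (w t) x y.+1 - lpp (w t) x y.
  by rewrite /sweep_field/= ltnn.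
apply: (expo_family_sub eX').
- move=> [a b]; rewrite /sweep_active /= => h; split; first by apply/idP; lia.
  by move=> [ax bx]; subst a b; lia.
- exact: measurable_sweep_field.
- exact: sweep_field_ge0.
- move=> [a b]; rewrite /sweep_active /= => h; apply/funext => t.
  rewrite fk fi fj; case: eqP => [[-> ->]|zi].
    rewrite /sweep_field/= eqxx lppSS.
    by rewrite /w; case: leP => h1; case: leP => h2; lra.
  case: eqP => [[-> ->]|zj].
    rewrite /sweep_field/= leqnn /vertical_increment /field lppSS.
    by rewrite /w; case: leP => h1; case: leP => h2; lra.
  rewrite /sweep_field/=; case: eqP => [a0|a0].
    case: eqP => // b0; rewrite (_ : (b <= y.+1) = (b <= y))%N//.
    by rewrite leq_eqVlt; case: eqP => // by1; case: zj; rewrite a0 by1.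
  by case: eqP.
- by [].
Qed.

Hypothesis eX : expo_family P [set z | z != (0, 0)%N] X (stationary_rate al be).

Lemma sweep_family x y : (y <= n)%N ->
  expo_family P (sweep_active x y) (sweep_field x y) (stationary_rate al be).
Proof.
elim: x y => [|x ihx]; elim=> [|y ihy] yn; try by apply: sweep_step => //;
  apply: ihy; exact: ltnW.
- apply: (expo_family_sub eX) => //.
  + by move=> [a b]; rewrite /sweep_active/= xpair_eqE; lia.
  + exact: measurable_sweep_field.
  + exact: sweep_field_ge0.
  + move=> [a b]; rewrite /sweep_active/= => h; apply/funext => t.
    rewrite /sweep_field/=; case: eqP => [a0|_].
      subst a; rewrite (_ : (b == 0)%N = false); last by lia.
      rewrite leqNgt lt0n (_ : (b == 0)%N = false)/=; last by lia.
      by case: b h => // b _; rewrite /vertical_increment lpp0S addrC addKr.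
    by case: eqP => // -[-> ->]; rewrite lppS0 addrC addKr.
- apply: (expo_family_sub (ihx n (leqnn n))) => //.
  + by move=> [a b]; rewrite /sweep_active/=; lia.
  + exact: measurable_sweep_field.
  + exact: sweep_field_ge0.
  + move=> [a b]; rewrite /sweep_active/= => h; apply/funext => t.
    rewrite /sweep_field/=; case: eqP => [a0|a0].
      case: eqP => // b0; rewrite (_ : (b <= 0)%N = false); last by lia.
      by rewrite (_ : (b <= n)%N = true); last by lia.
    rewrite !xpair_eqE; case: eqP => [ax|ax] /=.
      case: eqP => [bx|bx] /=.
        rewrite ifF; last by lia.
        by rewrite ax bx lppS0 addrC addKr.
      by rewrite ifF//; lia.
    by rewrite ifF//; lia.
Qed.

(** The increments along a vertical line of the stationary model have the
    law of the weights of the left axis, although they depend on the weights of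
    all columns up to it. *)
Lemma burke_vertical x :
  expo_family P [set z | [&& z.1 == 0, 0 < z.2 & z.2 <= n]%N]
    (sweep_field x 0) (fun=> be).
Proof.
apply: (expo_family_sub (sweep_family x (leq0n n))).
- by move=> [a b]; rewrite /sweep_active/=; lia.
- exact: measurable_sweep_field.
- exact: sweep_field_ge0.
- by [].
- by move=> [a b]; rewrite /stationary_rate/= => /andP[/eqP ->].
Qed.

Lemma sum_vertical x t :
  \sum_(z <- [seq (0%N, b) | b <- iota 1 n]) sweep_field x 0 z t =
  lpp (w t) x n - lpp (w t) x 0.
Proof.
rewrite big_map; elim: n => [|m ih]; first by rewrite big_nil subrr.
have -> : iota 1 m.+1 = iota 1 m ++ [:: m.+1].
  by rewrite -[m.+1 in LHS]addn1 iotaD add1n.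
rewrite big_cat/= ih big_seq1 /sweep_field/= /vertical_increment/= addrC addrA subrK.
by [].
Qed.

End sweep.

End burke_lpp.


(** * Deviation bounds *)

Section exp_inequalities.
Context {R : realType}.

(** These two inequalities put the Chernoff bounds in exponential form, with a
    quadratic error in the tilting parameter. *)
Lemma inv_1B_le_expR (u : R) : 0 <= u <= 1/2 -> (1 - u)^-1 <= expR (u + 2 * u ^+ 2).
Proof.
move=> u01; have h := expR_ge1Dx (u + 2 * u ^+ 2).
rewrite -[_^-1]mul1r ler_pdivrMr; last by lra.
apply: (le_trans _ (ler_wpM2r _ h)); last by lra.
have : 0 <= u ^+ 2 * (1 - 2 * u) by rewrite mulr_ge0 ?sqr_ge0//; lra.
by rewrite !expr2; lra.
Qed.

Lemma inv_1D_le_expR (u : R) : 0 <= u -> (1 + u)^-1 <= expR (- (u - u ^+ 2)).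
Proof.
move=> u0; have h := expR_ge1Dx (- (u - u ^+ 2)).
rewrite -[_^-1]mul1r ler_pdivrMr; last by lra.
apply: (le_trans _ (ler_wpM2r _ h)); last by lra.
have : 0 <= u ^+ 3 by rewrite exprn_ge0.
by rewrite !exprS expr0; lra.
Qed.

End exp_inequalities.

Section bounds.
Context {d : measure_display} {T : measurableType d} {R : realType}.
Variable P : probability T R.

Lemma union_bound (F : nat -> set T) n (b : R) (D : set T) :
  measurable D -> (forall i, (i < n)%N -> measurable (F i)) ->
  (forall i, (i < n)%N -> (P (F i) <= b%:E)%E) ->
  D `<=` \big[setU/set0]_(i < n) F i -> (P D <= (n%:R * b)%:E)%E.
Proof.
move=> mD mF Fb DF.
apply: (@le_trans _ _ (P (\big[setU/set0]_(i < n) F i))).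
  apply: le_measure => //; rewrite inE//.
  by apply: bigsetU_measurable => i _; apply: mF.
elim: n mF Fb {DF} => [|n ih] mF Fb; first by rewrite big_ord0 measure0 mul0r.
rewrite big_ord_recr/= -natr1 mulrDl mul1r EFinD.
apply: (le_trans (measureU2 _ _ _)).
- by apply: bigsetU_measurable => i _; apply: mF; exact: leqW.
- exact: mF.
- apply: leeD; last exact: Fb.
  by apply: ih => i i_n; [apply: mF|apply: Fb]; exact: ltnW.
Qed.

Variable I : choiceType.
Implicit Types (X : I -> T -> R) (r x : I -> R) (A S : set I) (s : seq I).

Lemma erlang_ge_exp A X s (u x : R) : expo_family P A X (fun=> 1) ->
  uniq s -> (forall i, i \in s -> A i) -> 0 <= u <= 1/2 -> 0 <= x ->
  (P [set w | (x <= \sum_(i <- s) X i w)%R] <=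
   (expR ((u + 2 * u ^+ 2) * (size s)%:R - u * x))%:E)%E.
Proof.
move=> eX us sA u01 x0; apply: (le_trans (erlang_ge (t := 1 - u) eX us sA _ x0)).
  by lra.
rewrite lee_fin (_ : 1 - (1 - u) = u); last by ring.
rewrite expRD ler_wpM2r ?expR_ge0//.
rewrite expRM_natr -exprVn lerXn2r ?nnegrE ?expR_ge0// ?invr_ge0; first by lra.
exact: inv_1B_le_expR.
Qed.

Lemma erlang_lt_exp A X s (u x : R) : expo_family P A X (fun=> 1) ->
  uniq s -> (forall i, i \in s -> A i) -> 0 <= u ->
  (P [set w | (\sum_(i <- s) X i w < x)%R] <=
   (expR (u * x - (u - u ^+ 2) * (size s)%:R))%:E)%E.
Proof.
move=> eX us sA u0; apply: (le_trans (erlang_lt (t := 1 + u) _ eX us sA _)).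
  by lra.
rewrite lee_fin (_ : 1 + u - 1 = u); last by ring.
rewrite [u * x - _]addrC expRD ler_wpM2r ?expR_ge0//.
rewrite -mulNr expRM_natr -exprVn lerXn2r ?nnegrE ?expR_ge0// ?invr_ge0; first by lra.
exact: inv_1D_le_expR.
Qed.

Lemma lln_ge A X s (c : R) : expo_family P A X (fun=> 1) ->
  uniq s -> (forall i, i \in s -> A i) -> 0 <= c <= 1 ->
  (P [set w | ((1 + c) * (size s)%:R <= \sum_(i <- s) X i w)%R] <=
   (expR (- (c ^+ 2 / 8 * (size s)%:R)))%:E)%E.
Proof.
move=> eX us sA c01.
apply: (le_trans (erlang_ge_exp (u := c / 4) eX us sA _ _)); first by lra.
  by rewrite mulr_ge0//; lra.
by rewrite lee_fin ler_expR !expr2 le_eqVlt; apply/orP; left; apply/eqP; field.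
Qed.

Lemma lln_lt A X s (c : R) : expo_family P A X (fun=> 1) ->
  uniq s -> (forall i, i \in s -> A i) -> 0 <= c ->
  (P [set w | (\sum_(i <- s) X i w < (1 - c) * (size s)%:R)%R] <=
   (expR (- (c ^+ 2 / 8 * (size s)%:R)))%:E)%E.
Proof.
move=> eX us sA c0.
apply: (le_trans (erlang_lt_exp (u := c / 2) _ eX us sA _)); first by lra.
rewrite lee_fin ler_expR.
have : 0 <= c ^+ 2 * (size s)%:R by rewrite mulr_ge0// exprn_ge0.
by move: (size s)%:R => m; rewrite !expr2; lra.
Qed.

End bounds.

Section reindex.
Context {d : measure_display} {T : measurableType d} {R : realType}.
Variable P : probability T R.

Lemma expo_family_reindex (I J : choiceType) (A : set I) (A' : set J)
    (X : I -> T -> R) (r : I -> R) (phi : J -> I) (g : I -> J) :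
  cancel phi g -> expo_family P A X r -> (forall j, A' j -> A (phi j)) ->
  expo_family P A' (fun j => X (phi j)) (fun j => r (phi j)).
Proof.
move=> phiK [mX X0 r0 XP] AA; split.
- by move=> j; exact: mX.
- by move=> j; exact: X0.
- by move=> j /AA; exact: r0.
- move=> s x us sA x0.
  under eq_bigr do rewrite -[X in _ * X](congr1 x (phiK _)).
  have := XP (map phi s) (fun i => x (g i)); rewrite big_map => <- //.
  + congr (P _); apply/seteqP; split=> t h i.
      by move=> /mapP[j js ->]; rewrite phiK; exact: h.
    by move=> is_; have := h _ (map_f phi is_); rewrite phiK.
  + by rewrite map_inj_uniq//; exact: can_inj phiK.
  + by move=> i /mapP[j /sA/AA ? ->].
Qed.

End reindex.


(** * The speed of the bulk *)

Section scaled_weights.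
Context {R : realType}.
Implicit Types (w : nat -> nat -> R) (x y d : nat).

(** Dividing unit exponential weights by the rates couples the stationary models
    for all parameters on one family. *)
Definition rescale (al be : R) w a b : R := (stationary_rate al be (a, b))^-1 * w a b.

Definition bulk w a b : R := if (a == 0%N) || (b == 0%N) then 0 else w a b.

Lemma lpp_rescale_row al be w x : lpp (rescale al be w) x 0 = al^-1 * lpp w x 0.
Proof.
elim: x => [|x ih]; first by rewrite !lpp00 mulr0.
by rewrite !lppS0 ih mulrDr.
Qed.

Lemma lpp_rescale_col al be w y : lpp (rescale al be w) 0 y = be^-1 * lpp w 0 y.
Proof.
elim: y => [|y ih]; first by rewrite !lpp00 mulr0.
by rewrite !lpp0S ih mulrDr.
Qed.

Lemma lpp_bulk_row w x : lpp (bulk w) x 0 = 0.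
Proof. by elim: x => [|x ih] //; rewrite lppS0 ih add0r /bulk orbT. Qed.

Lemma lpp_bulk_col w y : lpp (bulk w) 0 y = 0.
Proof. by elim: y => [|y ih] //; rewrite lpp0S ih add0r. Qed.

Lemma lpp_ler_mono w x y y' : (forall a b, 0 <= w a b) -> (y <= y')%N ->
  lpp w x y <= lpp w x y'.
Proof.
move=> w0 /subnKC <-; elim: (y' - y)%N => [|k ih]; first by rewrite addn0.
by rewrite addnS (le_trans ih)// lpp_ler.
Qed.

Lemma lpp_lel_mono w x x' y : (forall a b, 0 <= w a b) -> (x <= x')%N ->
  lpp w x y <= lpp w x' y.
Proof.
move=> w0 /subnKC <-; elim: (x' - x)%N => [|k ih]; first by rewrite addn0.
by rewrite addnS (le_trans ih)// lpp_lel.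
Qed.

Lemma lpp_ge0 w x y : (forall a b, 0 <= w a b) -> 0 <= lpp w x y.
Proof.
move=> w0; apply: le_trans (lpp_lel_mono y w0 (leq0n x)).
exact: le_trans (lpp_ler_mono 0 w0 (leq0n y)).
Qed.

(** A path of the model with rates [1/2] either leaves the axes at distance
    at most [d], and then it collects at most [2] times the axis weights up to
    [d] on top of a bulk passage time; or it goes further along an axis. In the
    latter case lowering the rate of that axis to [al] increases its value by
    [al^-1 - 2] times those weights at least. Each of the four bounds satisfies
    the recursion, hence so does their maximum. *)
Lemma exit_point w (al be : R) d x y : (forall a b, 0 <= w a b) ->
  0 < al -> al <= 2^-1 -> 2^-1 <= be ->
  lpp (rescale 2^-1 2^-1 w) x y <=
  Num.max (Num.max (lpp (bulk w) x y + 2 * lpp w d 0) (lpp (bulk w) x y + 2 * lpp w 0 d))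
    (Num.max (lpp (rescale al be w) x y - (al^-1 - 2) * lpp w d 0)
             (lpp (rescale be al w) x y - (al^-1 - 2) * lpp w 0 d)).
Proof.
move=> w0 al0 al2 be2.
have ali : 2 <= al^-1 by rewrite -[leLHS]invrK lef_pV2 ?posrE ?invr_gt0.
pose F x y := Num.max
    (Num.max (lpp (bulk w) x y + 2 * lpp w d 0) (lpp (bulk w) x y + 2 * lpp w 0 d))
    (Num.max (lpp (rescale al be w) x y - (al^-1 - 2) * lpp w d 0)
             (lpp (rescale be al w) x y - (al^-1 - 2) * lpp w 0 d)).
apply: (@lpp_supersolution _ _ F) => {x y} [x|y|x y]; rewrite /F.
- rewrite !lpp_rescale_row lpp_bulk_row !add0r invrK !le_max.
  have [xd|/ltnW dx] := leqP x d.
    by apply/orP; left; apply/orP; left; rewrite ler_pM2l//; exact: lpp_lel_mono.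
  apply/orP; right; apply/orP; left.
  have := ler_wpM2l (_ : 0 <= al^-1 - 2) (lpp_lel_mono 0 w0 dx).
  by rewrite subr_ge0 => /(_ ali); lra.
- rewrite !lpp_rescale_col lpp_bulk_col !add0r invrK !le_max.
  have [yd|/ltnW dy] := leqP y d.
    by apply/orP; left; apply/orP; right; rewrite ler_pM2l//; exact: lpp_ler_mono.
  apply/orP; right; apply/orP; right.
  have := ler_wpM2l (_ : 0 <= al^-1 - 2) (lpp_ler_mono 0 w0 dy).
  by rewrite subr_ge0 => /(_ ali); lra.
- rewrite !lppSS /rescale /bulk /stationary_rate/= !invr1 !mul1r.
  set k := w _ _; set p := lpp w d 0; set q := lpp w 0 d.
  have ml (a b : R) : a <= Num.max a b by rewrite le_max lexx.
  have mr (a b : R) : b <= Num.max a b by rewrite le_max lexx orbT.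
  rewrite -lerBrDl ge_max; apply/andP; split; rewrite !ge_max -!andbA;
    apply/and4P; split; rewrite lerBrDl !le_max.
  + by rewrite addrA lerD2r lerD2l ml.
  + by rewrite addrA lerD2r lerD2l ml orbT.
  + by rewrite addrA lerD2r lerD2l ml !orbT.
  + by rewrite addrA lerD2r lerD2l ml !orbT.
  + by rewrite addrA lerD2r lerD2l mr.
  + by rewrite addrA lerD2r lerD2l mr orbT.
  + by rewrite addrA lerD2r lerD2l mr !orbT.
  + by rewrite addrA lerD2r lerD2l mr !orbT.
Qed.

End scaled_weights.

Section erlang_sums.
Context {d : measure_display} {T : measurableType d} {R : realType}.
Variable P : probability T R.

(** The law of [f] is that of a sum of [n] independent unit exponential variables,
    through an explicit representation: deviation bounds for passage times are
    then read off from those for sums. *)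
Definition erlang_sum n (f : T -> R) : Prop :=
  exists (I : choiceType) (A : set I) (X : I -> T -> R) (s : seq I),
    [/\ expo_family P A X (fun=> 1), uniq s, forall i, i \in s -> A i,
        size s = n & forall t, f t = \sum_(i <- s) X i t].

Lemma erlang_sum_measurable n f : erlang_sum n f -> measurable_fun setT f.
Proof.
move=> [I [A [X [s [[mX _ _ _] us sA sn fE]]]]].
by rewrite (funext fE); exact: measurable_sumX.
Qed.

Lemma erlang_sum_lln_ge n f c b : erlang_sum n f -> 0 <= c <= 1 ->
  expR (- (c ^+ 2 / 8 * n%:R)) <= b ->
  (P [set w | ((1 + c) * n%:R <= f w)%R] <= b%:E)%E.
Proof.
move=> [I [A [X [s [eX us sA sn fE]]]]] c01 hb.
under eq_set do rewrite fE.
by rewrite -sn in hb *; apply: (le_trans (lln_ge eX us sA c01)); rewrite lee_fin.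
Qed.

Lemma erlang_sum_lln_lt n f c b : erlang_sum n f -> 0 <= c ->
  expR (- (c ^+ 2 / 8 * n%:R)) <= b ->
  (P [set w | (f w < (1 - c) * n%:R)%R] <= b%:E)%E.
Proof.
move=> [I [A [X [s [eX us sA sn fE]]]]] c0 hb.
under eq_set do rewrite fE.
by rewrite -sn in hb *; apply: (le_trans (lln_lt eX us sA c0)); rewrite lee_fin.
Qed.

Lemma erlang_sum_ge_exp n f (u x : R) : erlang_sum n f -> 0 <= u <= 1/2 -> 0 <= x ->
  (P [set w | (x <= f w)%R] <= (expR ((u + 2 * u ^+ 2) * n%:R - u * x))%:E)%E.
Proof.
move=> [I [A [X [s [eX us sA sn fE]]]]] u0 x0.
under eq_set do rewrite fE.
by rewrite -sn; exact: (erlang_ge_exp eX us sA).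
Qed.
Definition unit_field (X : nat * nat -> T -> R) : Prop :=
  expo_family P [set z | z != (0, 0)%N] X (fun=> 1).

Variable X : nat * nat -> T -> R.
Hypothesis eX : unit_field X.

Let w t := field X t.

Lemma row_erlang n : erlang_sum n (fun t => lpp (w t) n 0).
Proof.
exists (nat * nat)%type, [set z | z != (0, 0)%N], X, [seq (a, 0%N) | a <- iota 1 n].
split => //.
- by rewrite map_inj_uniq ?iota_uniq// => a b [].
- by move=> z /mapP[a]; rewrite mem_iota => + ->; rewrite /= xpair_eqE; lia.
- by rewrite size_map size_iota.
- move=> t; rewrite big_map; elim: n => [|m ih]; first by rewrite big_nil.
  have -> : iota 1 m.+1 = iota 1 m ++ [:: m.+1].
    by rewrite -[m.+1 in LHS]addn1 iotaD add1n.
  by rewrite lppS0 big_cat/= -ih big_seq1.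
Qed.

Lemma col_erlang n : erlang_sum n (fun t => lpp (w t) 0 n).
Proof.
exists (nat * nat)%type, [set z | z != (0, 0)%N], X, [seq (0%N, a) | a <- iota 1 n].
split => //.
- by rewrite map_inj_uniq ?iota_uniq// => a b [].
- by move=> z /mapP[a]; rewrite mem_iota => + ->; rewrite /= xpair_eqE; lia.
- by rewrite size_map size_iota.
- move=> t; rewrite big_map; elim: n => [|m ih]; first by rewrite big_nil.
  have -> : iota 1 m.+1 = iota 1 m ++ [:: m.+1].
    by rewrite -[m.+1 in LHS]addn1 iotaD add1n.
  by rewrite lpp0S big_cat/= -ih big_seq1.
Qed.

(** [burke_vertical] in terms of the unit weights. *)
Lemma vertical_erlang (al be : R) x n : 0 < al -> 0 < be -> al + be = 1 ->
  erlang_sum n (fun t => be * (lpp (rescale al be (w t)) x n -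
                               lpp (rescale al be (w t)) x 0)).
Proof.
move=> al0 be0 albe.
have rate0 z : 0 < stationary_rate al be z.
  by rewrite /stationary_rate; case: ifP => // _; case: ifP.
pose Xs z t := (stationary_rate al be z)^-1 * X z t.
have eXs : expo_family P [set z | z != (0, 0)%N] Xs (stationary_rate al be).
  have h := expo_family_scale (c := fun z => (stationary_rate al be z)^-1) _ eX.
  apply: (expo_family_sub (h _)) => //.
  - by move=> z; rewrite invr_gt0.
  - by have [mX _ _ _] := eX; move=> z; apply: measurable_funM.
  - by have [_ X0 _ _] := eX; move=> z t; rewrite mulr_ge0// invr_ge0 ltW.
  - by move=> z _; rewrite invrK mul1r.
have [mXs Xs0 _ _] := eXs.
have eV := burke_vertical n mXs Xs0 albe eXs x.
have eV' := expo_family_scale (c := fun=> be) (fun=> be0) eV.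
rewrite divff ?gt_eqF// in eV'.
exists (nat * nat)%type, [set z | [&& z.1 == 0%N, (0 < z.2)%N & (z.2 <= n)%N]],
  (fun z t => be * sweep_field Xs x 0 z t), [seq (0%N, b) | b <- iota 1 n].
split; first exact: eV'.
- by rewrite map_inj_uniq ?iota_uniq// => a b [].
- by move=> z /mapP[a]; rewrite mem_iota => + ->; rewrite /=; lia.
- by rewrite size_map size_iota.
- by move=> t; rewrite -mulr_sumr sum_vertical.
Qed.

End erlang_sums.


(** The parameters are chosen so that the last two alternatives of
    [exit_point] are impossible for typical values. Moving the rates by
    [tau] raises the stationary speed [al^-1 + be^-1] by [O(tau ^ 2)] only,
    whereas the axis weights up to distance [dd], of order [delta * l], are
    worth at least [(al^-1 - 2) dd / 2], of order [tau * delta * l]. The factor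
    42 between [delta] and [tau] lets the gain win. *)
Lemma exit_point_arith (R : realType) (delta tau al be l dd G h hd vd V V1 V2 : R) :
  delta = 42 * tau -> al = 2^-1 - tau -> be = 2^-1 + tau ->
  0 < tau -> delta <= 1 / 8 -> 0 < l -> delta / 2 * l <= dd -> dd <= delta * l ->
  (1 - tau ^+ 2 / 4) * l <= h -> (1 - tau ^+ 2 / 4) * l <= 2^-1 * V ->
  h <= (1 + tau ^+ 2) * l ->
  be * V1 <= (1 + tau ^+ 2) * l -> al * V2 <= (1 + tau ^+ 2) * l ->
  hd <= 2 * dd -> vd <= 2 * dd -> dd / 2 <= hd -> dd / 2 <= vd ->
  V + 2 * h <= Num.max (Num.max (G + 2 * hd) (G + 2 * vd))
    (Num.max (V1 + al^-1 * h - (al^-1 - 2) * hd)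
       (V2 + be^-1 * h - (al^-1 - 2) * vd)) ->
  (4 - 8 * delta) * l <= G.
Proof.
move=> dE alE beE t0 d1 l0 dl dh hl Vl hu V1u V2u hdu vdu hdl vdl.
have t1 : tau <= 1 / 8 by lra.
have al0 : 0 < al by rewrite alE; lra.
have be0 : 0 < be by rewrite beE; lra.
have q0 : 0 < tau ^+ 2 * l by rewrite mulr_gt0// exprn_gt0.
have tt : tau ^+ 2 <= tau by rewrite expr2 ler_piMr ?(ltW t0)//; lra.
have qp : tau ^+ 2 * l <= tau * l := ler_wpM2r (ltW l0) tt.
have ali : 4 * tau <= al^-1 - 2.
  rewrite lerBrDr -[leRHS]mul1r ler_pdivlMr// alE.
  have := mulr_ge0 (ltW t0) (ltW t0); lra.
(* The speed [1 / (al * be)] is [4 / (1 - 4 tau ^ 2)]. *)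
have s4 : al^-1 + be^-1 <= 4 + 20 * tau ^+ 2.
  rewrite (_ : al^-1 + be^-1 = (al * be)^-1); last first.
    rewrite [RHS](_ : _ = (al + be) / (al * be)); first by field; rewrite !gt_eqF.
    by rewrite (_ : al + be = 1) ?mul1r// alE beE; lra.
  rewrite -[_^-1]mul1r ler_pdivrMr ?mulr_gt0// alE beE.
  have : 0 <= tau ^+ 2 * (1 - 20 * tau ^+ 2).
    rewrite mulr_ge0 ?sqr_ge0// subr_ge0 expr2.
    have := ler_pM (ltW t0) (ltW t0) t1 t1; lra.
  by rewrite !expr2; lra.
have corner : al^-1 * ((1 + tau ^+ 2) * l) + be^-1 * ((1 + tau ^+ 2) * l) <=
    4 * l + 40 * (tau ^+ 2 * l).
  rewrite -mulrDl; have s0 : 0 <= (1 + tau ^+ 2) * l.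
    by rewrite mulr_ge0 ?(ltW l0)// addr_ge0// sqr_ge0.
  apply: (le_trans (ler_wpM2r s0 s4)).
  have : 0 <= tau ^+ 2 * l * (16 - 20 * tau ^+ 2).
    rewrite mulr_ge0 ?(ltW q0)// subr_ge0 expr2.
    have := ler_pM (ltW t0) (ltW t0) t1 t1; lra.
  by rewrite !expr2; lra.
have ub3 (g : R) : dd / 2 <= g -> 42 * (tau ^+ 2 * l) <= (al^-1 - 2) * g.
  move=> dg; apply: (@le_trans _ _ (4 * tau * (delta / 2 * l / 2))).
    by rewrite expr2 dE; lra.
  apply: ler_pM => //; [lra| |lra].
  by rewrite divr_ge0// mulr_ge0 ?(ltW l0)//; lra.
have hal : al^-1 * h <= al^-1 * ((1 + tau ^+ 2) * l) by rewrite ler_wpM2l// invr_ge0 ltW.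
have hbe : be^-1 * h <= be^-1 * ((1 + tau ^+ 2) * l) by rewrite ler_wpM2l// invr_ge0 ltW.
have V1u' : V1 <= be^-1 * ((1 + tau ^+ 2) * l) by rewrite ler_pdivlMl.
have V2u' : V2 <= al^-1 * ((1 + tau ^+ 2) * l) by rewrite ler_pdivlMl.
have dtl : delta * l = 42 * (tau * l) by rewrite dE mulrA.
have tl : 0 <= tau * l by rewrite mulr_ge0 ?ltW.
have := ub3 _ hdl; have := ub3 _ vdl.
rewrite !le_max -!orbA => u1 u2 /or4P[] H; lra.
Qed.

Section bulk_lower_tail.
Context {d : measure_display} {T : measurableType d} {R : realType}.
Variable P : probability T R.
Variable X : nat * nat -> T -> R.
Hypothesis eX : unit_field P X.

Let w t := field X t.

(** Outside of nine deviation events, the Erlang variables that enter are within a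
    factor [1 + O(tau ^ 2)] or 2 of their means, which puts [exit_point] in the
    range of [exit_point_arith]. *)
Lemma bulk_lower_tail (delta tau : R) (L n : nat) : delta = 42 * tau ->
  0 < tau -> delta <= 1 / 8 ->
  delta / 2 * L%:R <= n%:R -> n%:R <= delta * L%:R -> (n <= L)%N -> (0 < L)%N ->
  (P [set t | (lpp (bulk (w t)) L L < (4 - 8 * delta) * L%:R)%R] <=
   (9%:R * expR (- (tau ^+ 4 / 128 * n%:R)))%:E)%E.
Proof.
move=> dE t0 d1 nl nu nL L0.
have t1 : tau <= 1 / 8 by lra.
have [mX X0 _ _] := eX.
pose al : R := 2^-1 - tau; pose be : R := 2^-1 + tau.
have al0 : 0 < al by rewrite /al; lra.
have be0 : 0 < be by rewrite /be; lra.
have h2 : (0 : R) < 2^-1 by lra.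
have e1 := row_erlang eX L.
have e2 := vertical_erlang eX L L h2 h2 (_ : 2^-1 + 2^-1 = 1 :> R).
have e3 := vertical_erlang eX L L al0 be0 (_ : al + be = 1).
have e4 := vertical_erlang eX L L be0 al0 (_ : be + al = 1).
have {}e2 := e2 ltac:(lra); have {}e3 := e3 ltac:(rewrite /al /be; lra).
have {}e4 := e4 ltac:(rewrite /al /be; lra).
have e5 := row_erlang eX n; have e6 := col_erlang eX n.
(* The first five concern variables with [L] terms and a precision of order
   [tau ^ 2]; the last four concern the axis weights up to distance [n], and a factor 2. *)
pose F (i : nat) : set T := nth set0 [::
  [set t | lpp (w t) L 0 < (1 - tau ^+ 2 / 4) * L%:R];
  [set t | 2^-1 * (lpp (rescale 2^-1 2^-1 (w t)) L L -
             lpp (rescale 2^-1 2^-1 (w t)) L 0) < (1 - tau ^+ 2 / 4) * L%:R];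
  [set t | (1 + tau ^+ 2) * L%:R <= lpp (w t) L 0];
  [set t | (1 + tau ^+ 2) * L%:R <= be * (lpp (rescale al be (w t)) L L -
             lpp (rescale al be (w t)) L 0)];
  [set t | (1 + tau ^+ 2) * L%:R <= al * (lpp (rescale be al (w t)) L L -
             lpp (rescale be al (w t)) L 0)];
  [set t | (1 + 1) * n%:R <= lpp (w t) n 0];
  [set t | (1 + 1) * n%:R <= lpp (w t) 0 n];
  [set t | lpp (w t) n 0 < (1 - 2^-1) * n%:R];
  [set t | lpp (w t) 0 n < (1 - 2^-1) * n%:R]] i.
apply: (union_bound (F := F)).
- apply: measurable_lt; apply: (measurable_lpp (X := fun z t => bulk (w t) z.1 z.2)).
  by move=> a b _ _ _; rewrite /bulk/=; case: (_ || _); [exact: measurable_cst|exact: mX].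
- case => [_|]; first by apply: measurable_lt; exact: (erlang_sum_measurable e1).
  case => [_|]; first by apply: measurable_lt; exact: (erlang_sum_measurable e2).
  case => [_|]; first by apply: measurable_ge; exact: (erlang_sum_measurable e1).
  case => [_|]; first by apply: measurable_ge; exact: (erlang_sum_measurable e3).
  case => [_|]; first by apply: measurable_ge; exact: (erlang_sum_measurable e4).
  case => [_|]; first by apply: measurable_ge; exact: (erlang_sum_measurable e5).
  case => [_|]; first by apply: measurable_ge; exact: (erlang_sum_measurable e6).
  case => [_|]; first by apply: measurable_lt; exact: (erlang_sum_measurable e5).
  case => [_|]; first by apply: measurable_lt; exact: (erlang_sum_measurable e6).
  by [].
- have B (c : R) m : tau ^+ 2 / 4 <= c -> (n <= m)%N ->
      expR (- (c ^+ 2 / 8 * m%:R)) <= expR (- (tau ^+ 4 / 128 * n%:R)).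
    move=> tc nm; rewrite ler_expR lerN2 ler_pM//.
    + by rewrite divr_ge0// exprn_ge0// ltW.
    + have : (tau ^+ 2 / 4) ^+ 2 <= c ^+ 2.
        have tau40 : 0 <= tau ^+ 2 / 4 by rewrite divr_ge0// exprn_ge0// ltW.
        by apply: lerXn2r => //; rewrite nnegrE; exact: le_trans tc.
      by rewrite !exprS !expr0; lra.
    + by rewrite ler_nat.
  have c1 : tau ^+ 2 / 4 <= tau ^+ 2 by have := sqr_ge0 tau; lra.
  have c2 : 0 <= tau ^+ 2 by exact: sqr_ge0.
  have c3 : tau ^+ 2 <= 1 by rewrite expr_le1// ?ltW//; lra.
  case => [_|]; first by apply: (erlang_sum_lln_lt e1); [lra|exact: B].
  case => [_|]; first by apply: (erlang_sum_lln_lt e2); [lra|exact: B].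
  case => [_|]; first by apply: (erlang_sum_lln_ge e1); [lra|exact: B].
  case => [_|]; first by apply: (erlang_sum_lln_ge e3); [lra|exact: B].
  case => [_|]; first by apply: (erlang_sum_lln_ge e4); [lra|exact: B].
  case => [_|]; first by apply: (erlang_sum_lln_ge e5); [lra|apply: B => //; lra].
  case => [_|]; first by apply: (erlang_sum_lln_ge e6); [lra|apply: B => //; lra].
  case => [_|]; first by apply: (erlang_sum_lln_lt e5); [lra|apply: B => //; lra].
  case => [_|]; first by apply: (erlang_sum_lln_lt e6); [lra|apply: B => //; lra].
  by [].
- move=> t /= Gt; apply: contrapT => /= nF.
  have {}nF i : (i < 9)%N -> ~ F i t.
    by move=> i9 Fi; apply: nF; rewrite -bigcup_mkord; exists i.
  have w0 a b : 0 <= w t a b by exact: X0.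
  have := exit_point n L L w0 al0 (_ : al <= 2^-1) (_ : 2^-1 <= be).
  have -> : al <= 2^-1 by rewrite /al; lra.
  have -> : 2^-1 <= be by rewrite /be; lra.
  move=> /(_ isT isT) h.
  have ge_of i (f : T -> R) c : (i < 9)%N -> F i = [set t | f t < c] -> c <= f t.
    by move=> i9 FE; have := nF i i9; rewrite FE /= => /negP; rewrite -leNgt.
  have le_of i (f : T -> R) c : (i < 9)%N -> F i = [set t | c <= f t] -> f t <= c.
    by move=> i9 FE; have := nF i i9; rewrite FE /= => /negP; rewrite -ltNge => /ltW.
  move: Gt; apply/negP; rewrite -leNgt.
  have h0 := ge_of 0%N _ _ isT erefl; have h1 := ge_of 1%N _ _ isT erefl.
  have h2' := le_of 2%N _ _ isT erefl; have h3 := le_of 3%N _ _ isT erefl.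
  have h4 := le_of 4%N _ _ isT erefl; have h5 := le_of 5%N _ _ isT erefl.
  have h6 := le_of 6%N _ _ isT erefl; have h7 := ge_of 7%N _ _ isT erefl.
  have h8 := ge_of 8%N _ _ isT erefl.
  rewrite /= in h0 h1 h2' h3 h4 h5 h6 h7 h8.
  apply: (@exit_point_arith R delta tau al be L%:R n%:R _ _ (lpp (w t) n 0) (lpp (w t) 0 n)
    _ _ _ dE erefl erefl t0 d1 _ nl nu h0 h1 h2' h3 h4).
  - by rewrite ltr0n.
  - by move: h5; rewrite -[1 + 1]/(2%:R).
  - by move: h6; rewrite -[1 + 1]/(2%:R).
  - by apply: le_trans h7; lra.
  - by apply: le_trans h8; lra.
  - move: h; rewrite !lpp_rescale_row invrK.
    by rewrite /al /be; rewrite !subrK.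
Qed.

End bulk_lower_tail.


(** * Up-right walks *)

Section walks.
Implicit Types (u v z : site) (p g : seq site).

Definition stepb u v : bool := (v == u + e1) || (v == u + e2).

Lemma stepbP u v : reflect ((v.1 = u.1 + 1 /\ v.2 = u.2) \/ (v.1 = u.1 /\ v.2 = u.2 + 1))
  (stepb u v).
Proof.
case: u v => [a b] [a' b']; rewrite /stepb /e1 /e2 !xpair_eqE/= !addr0.
apply: (iffP orP) => -[/=|/=] h; [left|right|left|right]; move: h.
- by move=> /andP[/eqP -> /eqP ->].
- by move=> /andP[/eqP -> /eqP ->].
- by move=> [-> ->]; rewrite !eqxx.
- by move=> [-> ->]; rewrite !eqxx.
Qed.

Lemma walk_dist u p : path stepb u p ->
  [/\ u.1 <= (last u p).1, u.2 <= (last u p).2 & l1_dist u (last u p) = size p].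
Proof.
elim: p u => [|z p ih] u /=.
  by move=> _; rewrite !lexx /l1_dist !subrr absz0.
move=> /andP[/stepbP uz /ih]; rewrite /l1_dist => -[h1 h2 h3].
by split; lia.
Qed.

Lemma mem_walk u p z : path stepb u p -> z \in p ->
  [/\ u.1 <= z.1, u.2 <= z.2, z.1 <= (last u p).1, z.2 <= (last u p).2 & z != u].
Proof.
move=> + zp; case/path.splitP: zp => p1 p2; rewrite -cats1 -catA cat_path => /andP[w1 /=].
move=> /andP[/stepbP s w2]; rewrite last_cat/=.
have [a1 a2 _] := walk_dist w1; have [b1 b2 _] := walk_dist w2.
split; try lia.
by apply/eqP => zu; rewrite zu in s; lia.
Qed.

Lemma up_right_pathP u v g : up_right_path u v g <->
  exists p, [/\ g = u :: p, path stepb u p & last u p = v].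
Proof.
split.
  case: g => [[//]|z p [/= [sp] zu lv st]]; exists p; rewrite zu in lv st *.
  split => //.
    apply/(pathP u) => i ip; rewrite sp in ip.
    have := st _ ip; rewrite /= => -[h|h]; apply/orP; [left|right];
      by rewrite -h addrC subrK.
  by rewrite (last_nth u) sp.
move=> [p [-> w <-]]; have [_ _ sp] := walk_dist w.
split => //.
- by rewrite sp.
- by rewrite sp (last_nth u).
- rewrite sp => i ip; move/(pathP u) : w => /(_ _ ip) /orP[/eqP|/eqP] /= ->;
    rewrite addrAC subrr add0r; [by left|by right].
Qed.

Variable R : realType.
Implicit Types (om : site -> R).

Lemma passage_time_walk om u p : path stepb u p ->
  passage_time om u (u :: p) = \sum_(z <- p) om z.
Proof.
move=> w; rewrite /passage_time big_cons eqxx/=.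
rewrite big_seq_cond [RHS]big_seq; apply: eq_bigl => z.
by case zp: (z \in p) => //=; have [_ _ _ _ ->] := mem_walk w zp.
Qed.

(** Summing along the walk telescopes the right-hand sides. Exhibiting [Phi] is
    how all paths confined to [D] are bounded at once. *)
Lemma walk_potential om (Phi : site -> R) (D : site -> Prop) u p :
  (forall z z', D z -> D z' -> stepb z z' -> om z' <= Phi z' - Phi z) ->
  D u -> (forall z, z \in p -> D z) -> path stepb u p ->
  \sum_(z <- p) om z <= Phi (last u p) - Phi u.
Proof.
move=> h; elim: p u => [|z p ih] u Du Dp /=; first by rewrite big_nil subrr.
move=> /andP[uz w]; rewrite big_cons.
have Dz : D z by apply: Dp; rewrite mem_head.
have Dp' z' : z' \in p -> D z' by move=> z'p; apply: Dp; rewrite inE z'p orbT.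
have := ih z Dz Dp' w.
by have := h u z Du Dz uz; lra.
Qed.

(** Lower bounds for passage times, composable by concatenation of walks. *)
Definition reach om u v (x : R) : Prop :=
  exists p, [/\ path stepb u p, last u p = v & x <= \sum_(z <- p) om z].

Lemma reach0 om u : reach om u u 0.
Proof. by exists [::]; rewrite big_nil. Qed.

Lemma reach_trans om u v z x y : reach om u v x -> reach om v z y ->
  reach om u z (x + y).
Proof.
move=> [p [wp lp xp]] [q [wq lq yq]]; exists (p ++ q).
by rewrite cat_path wp last_cat lp wq big_cat/= lerD.
Qed.

Lemma reach_step om u v z x : stepb v z -> reach om u v x ->
  reach om u z (x + om z).
Proof.
move=> vz h; apply: (reach_trans h); exists [:: z].
by rewrite big_seq1 /= vz.
Qed.

Lemma reach_le om u v x y : y <= x -> reach om u v x -> reach om u v y.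
Proof. by move=> yx [p [wp lp xp]]; exists p; split => //; exact: le_trans xp. Qed.

Definition translate om u (a b : nat) : R := om (u + (a%:Z, b%:Z)).

Lemma reach_bulk om u x y : (forall z, 0 <= om z) ->
  reach om u (u + (x%:Z, y%:Z)) (lpp (bulk (translate om u)) x y).
Proof.
move=> om0.
have st1 a b : stepb (u + (a%:Z, b%:Z)) (u + (a.+1%:Z, b%:Z)).
  by apply/stepbP; left => /=; lia.
have st2 a b : stepb (u + (a%:Z, b%:Z)) (u + (a%:Z, b.+1%:Z)).
  by apply/stepbP; right => /=; lia.
elim: x y => [|x ihx]; elim=> [|y ihy].
- by rewrite addr0; exact: reach0.
- rewrite lpp_bulk_col; rewrite lpp_bulk_col in ihy.
  by apply: (reach_le _ (reach_step (st2 0%N y) ihy)); rewrite add0r.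
- have := ihx 0%N; rewrite !lpp_bulk_row => ihx0.
  by apply: (reach_le _ (reach_step (st1 x 0%N) ihx0)); rewrite add0r.
- have e : bulk (translate om u) x.+1 y.+1 = om (u + (x.+1%:Z, y.+1%:Z)) by [].
  rewrite lppSS e [om _ + _]addrC; case: leP => _.
    exact: (reach_step (st2 _ _) (ihy)).
  exact: (reach_step (st1 _ _) (ihx _)).
Qed.

End walks.


(** * Rare independent events *)

Section small_exponentials.
Context {R : realType}.

Lemma expR_small (c p : R) : 0 < c -> 0 < p ->
  exists N : nat, forall n, (N <= n)%N -> expR (- (c * n%:R)) <= p.
Proof.
move=> c0 p0; exists (Num.bound (c^-1 * p^-1)) => n hn.
have pn : p^-1 <= c * n%:R.
  rewrite -ler_pdivrMl// ltW// (lt_le_trans (archi_boundP _)) ?ler_nat//.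
  by rewrite mulr_ge0// invr_ge0 ltW.
rewrite expRN -[leRHS]invrK lef_pV2 ?posrE ?invr_gt0 ?expR_gt0//.
apply: (le_trans pn); have := expR_ge1Dx (c * n%:R); lra.
Qed.

End small_exponentials.

Lemma measurable_bulk d (T : measurableType d) (R : realType)
    (X : nat * nat -> T -> R) x y :
  (forall a b, (0 < a <= x)%N -> (0 < b <= y)%N -> measurable_fun setT (X (a, b))) ->
  measurable_fun setT (fun t => lpp (bulk (fun a b => X (a, b) t)) x y).
Proof.
move=> mX; apply: (measurable_lpp (X := fun z t => bulk (fun a b => X (a, b) t) z.1 z.2)).
move=> a b ax by_ _; rewrite /bulk/=; case: eqP => [_|/eqP] /=.
  exact: measurable_cst.
rewrite -lt0n => a0; case: eqP => [_|/eqP]; first exact: measurable_cst.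
by rewrite -lt0n => b0; apply: mX; apply/andP.
Qed.

Section independent_events.
Context {d : measure_display} {T : measurableType d} {R : realType}.
Variable P : probability T R.

(** The speed 4 as a lower bound in probability, with one scale [L] that serves all
    fields. *)
Lemma bulk_lln (eps p : R) : 0 < eps -> 0 < p -> exists2 L : nat, (0 < L)%N &
  forall X : nat * nat -> T -> R, unit_field P X ->
  (P [set t | (lpp (bulk (field X t)) L L < (4 - eps) * L%:R)%R] <= p%:E)%E.
Proof.
move=> eps0 p0.
pose delta : R := Num.min eps 1 / 8.
have m0 : 0 < Num.min eps 1 by rewrite lt_min eps0 ltr01.
have d0 : 0 < delta by rewrite divr_gt0.
have d1 : delta <= 1 / 8 by rewrite ler_pM2r// ge_min lexx orbT.
have de : 8 * delta <= eps by rewrite /delta mulrC divfK// ge_min lexx.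
pose tau := delta / 42.
have dE : delta = 42 * tau by rewrite /tau mulrC divfK.
have t0 : 0 < tau by rewrite divr_gt0.
have c0 : 0 < tau ^+ 4 / 128 by rewrite divr_gt0// exprn_gt0.
have p9 : 0 < p / 9 by rewrite divr_gt0.
have [N hN] := expR_small c0 p9.
pose n := N.+1.
have n1 : 1 <= n%:R :> R by rewrite ler1n.
have d2 : 0 < delta / 2 by rewrite divr_gt0.
have x0 : 0 <= n%:R / (delta / 2) by rewrite divr_ge0// ltW.
pose L := Num.truncn (n%:R / (delta / 2)).
have /andP[Ll Lu] : L%:R <= n%:R / (delta / 2) < L.+1%:R by exact: truncn_itv.
move: Ll Lu; rewrite ler_pdivlMr// ltr_pdivrMr// -(natr1 L) => Ll Lu.
have Lu' : n%:R <= delta * L%:R.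
  have h16 : (L%:R + 1) * (delta / 2) <= (L%:R + 1) * (1 / 16).
    by rewrite ler_wpM2l//; lra.
  have : 0 <= delta * (L%:R - 1) by rewrite mulr_ge0 ?(ltW d0)//; lra.
  by lra.
have Ln : n%:R <= L%:R :> R.
  by apply: (le_trans Lu'); rewrite ler_piMl//; lra.
have nL : (n <= L)%N by rewrite ler_nat in Ln.
have L0 : (0 < L)%N := leq_trans (ltn0Sn N) nL.
exists L => [//|X eX].
have Ll' : delta / 2 * L%:R <= n%:R by rewrite mulrC.
have h := bulk_lower_tail eX dE t0 d1 Ll' Lu' nL L0.
apply: (@le_trans _ _ (9%:R * expR (- (tau ^+ 4 / 128 * n%:R)))%:E).
  apply: le_trans h; apply: le_measure; rewrite ?inE; last first.
  - by move=> t /=; move=> /lt_le_trans; apply; rewrite ler_wpM2r//; lra.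
  - by apply: measurable_lt; apply: measurable_bulk => a b _ _; case: eX.
  - by apply: measurable_lt; apply: measurable_bulk => a b _ _; case: eX.
rewrite lee_fin mulrC -ler_pdivlMr//; apply: hN.
exact: leqnSn.
Qed.

Variable I : choiceType.
Implicit Types (X : I -> T -> R) (A S : set I).

Lemma sig_lt X S (f : T -> R) c :
  measurable_fun (setT : set (g_sigma_algebraType (gens X S))) f ->
  sig X S [set t | f t < c].
Proof.
by move=> mf; exact: (@measurable_lt _ (g_sigma_algebraType (gens X S)) R f c mf).
Qed.

Lemma sig_ge X S (f : T -> R) c :
  measurable_fun (setT : set (g_sigma_algebraType (gens X S))) f ->
  sig X S [set t | c <= f t].
Proof.
by move=> mf; exact: (@measurable_ge _ (g_sigma_algebraType (gens X S)) R f c mf).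
Qed.

Lemma sig_bigsetI (J : choiceType) X (S : J -> set I) (E : J -> set T) (s : seq J) :
  (forall j, sig X (S j) (E j)) ->
  sig X [set z | exists2 j, j \in s & S j z] (\big[setI/setT]_(j <- s) E j).
Proof.
move=> sE; elim: s => [|j s ih].
  by rewrite big_nil; exact: (@measurableT _ (g_sigma_algebraType (gens X _))).
rewrite big_cons; apply: (@measurableI _ (g_sigma_algebraType (gens X _))).
  by apply: sig_sub (sE j) => z Sz; exists j => //; rewrite mem_head.
by apply: sig_sub ih => z [k ks Sz]; exists k => //; rewrite inE ks orbT.
Qed.

Lemma sig_indep_seq (J : choiceType) X A r (S : J -> set I) (E : J -> set T)
    (s : seq J) :
  expo_family P A X r -> (forall j, S j `<=` A) -> uniq s ->
  (forall i j, i != j -> S i `&` S j = set0) -> (forall j, sig X (S j) (E j)) ->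
  P (\big[setI/setT]_(j <- s) E j) = (\prod_(j <- s) P (E j))%E.
Proof.
move=> eX SA + dS sE; elim: s => [|j s ih] /=.
  by move=> _; rewrite !big_nil probability_setT.
move=> /andP[js us]; rewrite !big_cons -ih//.
apply: (sig_indep eX (S := S j) (S' := [set z | exists2 i, i \in s & S i z])) => //.
- by move=> z [i _]; exact: SA.
- rewrite -subset0 => z [Sj [i is_ Si]].
  have ij : i != j by apply/eqP => ij; rewrite -ij is_ in js.
  by have : (S i `&` S j) z by []; rewrite dS.
- exact: sig_bigsetI.
Qed.

Lemma union_bound_fin (J : finType) (F : J -> set T) (b : R) (D : set T) :
  measurable D -> (forall j, measurable (F j)) ->
  (forall j, (P (F j) <= b%:E)%E) -> (forall t, D t -> exists j, F j t) ->
  (P D <= (#|J|%:R * b)%:E)%E.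
Proof.
move=> mD mF Fb DF.
pose G (i : nat) := if insub i is Some o then F (enum_val (o : 'I_#|J|)) else set0.
have GE (i : nat) (iJ : (i < #|J|)%N) : G i = F (enum_val (Ordinal iJ)).
  by rewrite /G insubT.
apply: (union_bound (F := G)) => //.
- by move=> i iJ; rewrite (GE _ iJ).
- by move=> i iJ; rewrite (GE _ iJ).
- move=> t /DF[j Fj]; rewrite -bigcup_mkord; exists (enum_rank j) => /=.
    exact: ltn_ord.
  have h := ltn_ord (enum_rank j); rewrite (GE _ h).
  by rewrite (_ : Ordinal h = enum_rank j) ?enum_rankK//; apply: val_inj.
Qed.

(** There are [2 ^ #|J|] possible sets of bad indices. If one of them has at least
    [#|J| / s] elements, its events occur together with probability at most
    [(2 e) ^- #|J|]: the factor 2 pays for the choice of the set. *)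
Lemma many_rare_events (J : finType) X A r (S : J -> set I) (E : J -> set T)
    (s : nat) (D : set T) :
  expo_family P A X r -> (forall j, S j `<=` A) ->
  (forall i j, i != j -> S i `&` S j = set0) -> (forall j, sig X (S j) (E j)) ->
  (forall j, (P (E j) <= ((2 * expR 1) ^- s)%:E)%E) ->
  measurable D ->
  (forall t, D t -> (#|J| <= s * \sum_(j : J) `[< E j t >])%N) ->
  (P D <= (expR (- #|J|%:R))%:E)%E.
Proof.
move=> eX SA dS sE pE mD DE; have [mX _ _ _] := eX.
pose b : R := (2 * expR 1) ^- #|J|.
have e21 : 1 <= 2 * expR 1 :> R by have := expR_ge1Dx (1 : R); lra.
have mE j : measurable (E j) by exact: sig_measurable (sE j).
pose F (U : {set J}) := if (#|J| <= s * #|U|)%N then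
   \big[setI/setT]_(j <- enum U) E j else set0.
have := @union_bound_fin {set J} F b D mD _ _ _.
have -> : #|{set J}| = (2 ^ #|J|)%N.
  rewrite -(cardsT J) -card_powerset.
  by apply: eq_card => U; rewrite !inE finset.subsetT.
have -> : (2 ^ #|J|)%:R * b = expR (- #|J|%:R).
  rewrite /b natrX exprMn invfM mulrA divff ?mul1r ?expf_neq0//.
  by rewrite -expRM_natl mulr1 expRN.
apply.
- move=> U; rewrite /F; case: ifP => // _.
  by apply: bigsetI_measurable => j _.
- move=> U; rewrite /F; case: ifPn => [JU|_]; last first.
    by rewrite measure0 lee_fin invr_ge0 exprn_ge0// (le_trans _ e21).
  rewrite (sig_indep_seq eX SA _ dS sE) ?enum_uniq//.
  apply: (@le_trans _ _ (((2 * expR 1) ^- s) ^+ #|U|)%:E).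
    rewrite cardE; elim: (enum U) => [|j l ih]; first by rewrite big_nil.
    rewrite big_cons/= exprS EFinM; apply: lee_pmul => //.
    by apply: prode_ge0.
  rewrite lee_fin /b -exprVn -exprM exprVn lef_pV2 ?posrE ?exprn_gt0 ?(lt_le_trans _ e21)//.
  exact: ler_weXn2l.
- move=> t /DE JE; exists [set j | `[< E j t >]]%SET; rewrite /F ifT.
    rewrite -bigcap_seq => j /=; rewrite mem_enum inE => /asboolP //.
  by rewrite -sum1dep_card big_mkcond/=; apply: (leq_trans JE); rewrite leq_mul2l leq_sum ?orbT.
Qed.

End independent_events.


(** * The upper bound *)

Section corner.
Context {R : realType}.
Implicit Types (om : site -> R) (n : nat).

Definition row_sites n : seq site := [seq (i.+1%:Z, 0) | i <- iota 0 n].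
Definition col_sites (x : int) n : seq site := [seq (x, i.+1%:Z) | i <- iota 0 n].
Definition corner_sites n := row_sites n ++ col_sites n%:Z n.

(** A path through the corner stays on the bottom row before it and on the right
    column after it; along these the partial sums form a potential. *)
Lemma corner_passage om n g : up_right_path (0, 0) (n%:Z, n%:Z) g ->
  ((n%:Z, 0) : site) \in g ->
  passage_time om (0, 0) g <= \sum_(z <- corner_sites n) om z.
Proof.
move=> /up_right_pathP[p [-> w lp]] np; rewrite passage_time_walk//.
pose H a := \sum_(0 <= i < a) om (i.+1%:Z, 0).
pose V b := \sum_(0 <= i < b) om (n%:Z, i.+1%:Z).
have -> : \sum_(z <- corner_sites n) om z = H n + V n.
  by rewrite big_cat/= !big_map /H /V /index_iota subn0.
pose Phi (z : site) := if z.2 == 0 then H `|z.1|%N else H n + V `|z.2|%N.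
pose D (z : site) : Prop := [/\ 0 <= z.1 <= n%:Z, 0 <= z.2 <= n%:Z &
  (z.2 = 0) \/ (z.1 = n%:Z)].
have D0 : D (0, 0) by split => //=; left.
have Dp z : z \in p -> D z.
  move=> zp; have [/= z1 z2 z3 z4 _] := mem_walk w zp; rewrite lp/= in z3 z4.
  split; rewrite ?z1 ?z2//.
  move: np; rewrite inE => /predU1P[[n0]|np].
    by right; rewrite n0 in z3 *; lia.
  move: zp; case/path.splitP: np w lp => p1 p2; rewrite -cats1 -catA cat_path /=.
  move=> /andP[w1 /andP[s w2]]; rewrite last_cat/= => lp.
  rewrite mem_cat inE => /orP[zp|/predU1P[->|zp]]; [|by left|].
    have w1' : path stepb (0, 0) (rcons p1 (n%:Z, 0)) by rewrite rcons_path w1.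
    have zp' : z \in rcons p1 (n%:Z, 0) by rewrite mem_rcons inE zp orbT.
    have [_ _ _ h _] := mem_walk w1' zp'; rewrite last_rcons/= in h.
    by left; lia.
  by have [/= h _ _ _ _] := mem_walk w2 zp; right; lia.
have := walk_potential (om := om) (Phi := Phi) (D := D) _ D0 Dp w.
have -> : Phi (0, 0) = 0 by rewrite /Phi/= /H big_nil.
have -> : Phi (last (0, 0) p) = H n + V n.
  rewrite lp /Phi/=; case: eqP => // n0; have -> : n = 0%N by lia.
  by rewrite /H /V !big_nil addr0.
rewrite subr0; apply => z z' Dz Dz' st; rewrite /Phi.
  move: z z' Dz Dz' st.
  move=> [a b] [a' b'] [/= a0 b0 ab] [/= a0' b0' ab'] /stepbP/= [[ha hb]|[ha hb]].
    rewrite ha hb in a0' b0' ab' *; case: eqP => b1; last by lia.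
    rewrite b1 (_ : `|(a + 1)%R|%N = `|a|.+1); last by lia.
    rewrite /H big_nat_recr//= [X in _ <= X - _]addrC addrK.
    by rewrite (_ : `|a|.+1%:Z = a + 1) ?b1//; lia.
  rewrite ha hb in a0' b0' ab' *; rewrite ifF; last by lia.
  have an : a = n%:Z by lia.
  rewrite (_ : `|(b + 1)%R|%N = `|b|.+1); last by lia.
  rewrite /V big_nat_recr//= (_ : `|b|.+1%:Z = b + 1); last by lia.
  rewrite an; case: eqP => [->|_].
    by rewrite absz0 big_geq// !add0r [X in _ <= X - _]addrC addrK.
  by rewrite addrA [X in _ <= X - _]addrC addrK.
Qed.

Lemma reach_row om (u v : site) : (forall z, 0 <= om z) -> u.1 <= v.1 -> u.2 <= v.2 ->
  reach om u v 0.
Proof.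
move=> om0 uv1 uv2.
have h k (z z' : site) : z'.1 = z.1 + k%:Z -> z'.2 = z.2 -> reach om z z' 0.
  elim: k z' => [|k ih] z' h1 h2.
    rewrite addr0 in h1; have -> : z' = z by case: z z' h1 h2 => [? ?] [? ?] /= -> ->.
    exact: reach0.
  have := @reach_step _ om z (z'.1 - 1, z'.2) z' 0 _ (ih _ _ _).
  move=> h3; apply: (reach_le _ (h3 _ _ _)) => //; rewrite ?add0r//=.
  - by apply/stepbP; left => /=; lia.
  - by lia.
have h' k (z z' : site) : z'.2 = z.2 + k%:Z -> z'.1 = z.1 -> reach om z z' 0.
  elim: k z' => [|k ih] z' h1 h2.
    rewrite addr0 in h1; have -> : z' = z by case: z z' h1 h2 => [? ?] [? ?] /= -> ->.
    exact: reach0.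
  have := @reach_step _ om z (z'.1, z'.2 - 1) z' 0 _ (ih _ _ _).
  move=> h3; apply: (reach_le _ (h3 _ _ _)) => //; rewrite ?add0r//=.
  - by apply/stepbP; right => /=; lia.
  - by lia.
rewrite -(addr0 0); apply: (@reach_trans _ om u (v.1, u.2)).
  by apply: (h `|v.1 - u.1|%N) => //=; lia.
by apply: (h' `|v.2 - u.2|%N) => //=; lia.
Qed.

(** The blocks of the strip of index [k] lie along the diagonal shifted to the
    right by [k] blocks, each starting where the previous one ends. *)
Definition block_time om (L k i : nat) : R :=
  lpp (bulk (translate om (((i + k) * L)%N%:Z, (i * L)%N%:Z))) L L.

(** Concatenate optimal paths of the blocks of one strip, and join them to the
    two ends of the square at no loss. *)
Lemma reach_strip om L k m n : (forall z, 0 <= om z) ->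
  ((m + k) * L <= n)%N ->
  reach om (0, 0) (n%:Z, n%:Z) (\sum_(i < m) block_time om L k i).
Proof.
move=> om0 mn.
have h : reach om (0, 0) (((m + k) * L)%N%:Z, (m * L)%N%:Z) (\sum_(i < m) block_time om L k i).
  elim: m {mn} => [|m ih].
    by rewrite big_ord0; apply: reach_row => //=; lia.
  rewrite big_ord_recr/=; apply: (reach_trans ih).
  have := @reach_bulk _ om (((m + k) * L)%N%:Z, (m * L)%N%:Z) L L om0.
  congr (reach _ _ _ _); rewrite /= -[LHS]/((_ + _, _ + _) : site).
  by congr (_, _); rewrite -PoszD; congr Posz; lia.
rewrite -[\sum_(_ < _) _]addr0; apply: (reach_trans h).
by apply: reach_row => //=; lia.
Qed.

Lemma corner_geodesic_ge om L k m n g : (forall z, 0 <= om z) ->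
  ((m + k) * L <= n)%N -> is_geodesic om (0, 0) (n%:Z, n%:Z) g ->
  ((n%:Z, 0) : site) \in g ->
  \sum_(i < m) block_time om L k i <= \sum_(z <- corner_sites n) om z.
Proof.
move=> om0 mn [ug gmax] ng; apply: le_trans (corner_passage om ug ng).
have [p [wp lp le]] := reach_strip (k := k) (L := L) om0 mn.
apply: (le_trans le); rewrite -(passage_time_walk om wp).
by apply: gmax; apply/up_right_pathP; exists p.
Qed.

End corner.


Section upper_bound.
Context {d : measure_display} {T : measurableType d} {R : realType}.
Variable P : probability T R.
Variable om : site -> T -> R.
Hypothesis eO : expo_family P setT om (fun=> 1).

Lemma half_le_ln2 : 1 / 2 <= ln 2 :> R.
Proof.
rewrite -ler_expR lnK ?posrE//.
rewrite -[leRHS]invrK -[expR _]invrK lef_pV2 ?posrE ?invr_gt0 ?expR_gt0// -expRN.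
apply: le_trans (expR_ge1Dx _); lra.
Qed.

Lemma translate_unit_field (u : site) :
  unit_field P (fun z t => om (u + (z.1%:Z, z.2%:Z)) t).
Proof.
apply: (@expo_family_reindex _ _ _ P _ _ setT _ om (fun=> 1)
  (fun z : nat * nat => u + (z.1%:Z, z.2%:Z))
  (fun z : site => (`|(z.1 - u.1)%R|%N, `|(z.2 - u.2)%R|%N))) => //.
by move=> [a b] /=; congr (_, _); lia.
Qed.

Lemma interval_index (L a b : nat) (z : int) :
  (a * L)%N%:Z < z -> z <= (a * L + L)%N%:Z ->
  (b * L)%N%:Z < z -> z <= (b * L + L)%N%:Z -> a = b.
Proof.
move=> a1 a2 b1 b2; case: (ltngtP a b) => // ab.
  have := leq_mul2r L a.+1 b; rewrite ab orbT mulSn; lia.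
have := leq_mul2r L b.+1 a; rewrite ab orbT mulSn; lia.
Qed.

Definition cell (L k i : nat) : set site := [set z |
  [/\ ((i + k) * L)%N%:Z < z.1, z.1 <= ((i + k) * L + L)%N%:Z,
      (i * L)%N%:Z < z.2 & z.2 <= (i * L + L)%N%:Z]].

Lemma block_sig L k i c : sig om (cell L k i) [set t | block_time (om^~ t) L k i < c].
Proof.
apply: sig_lt.
pose u : site := (((i + k) * L)%N%:Z, (i * L)%N%:Z).
apply: (@measurable_bulk _ (g_sigma_algebraType (gens om (cell L k i))) R
  (fun z t => om (u + (z.1%:Z, z.2%:Z)) t)).
move=> a b aL bL; apply: sig_measurable_fun; rewrite /cell/=; split => /=; lia.
Qed.

(** If the corner path is a geodesic and weighs less than [(4 - 4 eps) n], then in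
    each strip at least the fraction [1 / s] of the blocks is slow, for
    [s > 4 / eps]: otherwise the strip alone would provide a heavier path. The
    blocks are independent, and slow with probability at most [(2 e) ^- s]. *)
Lemma strips_unlikely (eps : R) : 0 < eps < 1 -> exists N : nat, forall n, (N <= n)%N ->
  forall D : set T, measurable D ->
  (forall t, D t -> exists2 g, is_geodesic (om^~ t) (0, 0) (n%:Z, n%:Z) g &
     ((n%:Z, 0) : site) \in g) ->
  (forall t, D t -> \sum_(z <- corner_sites n) om z t < (4 - 4 * eps) * n%:R) ->
  (P D <= (expR (- n%:R))%:E)%E.
Proof.
move=> /andP[eps0 eps1]; have [mO O0 _ _] := eO.
pose s := (Num.truncn (4 / eps)).+1.
have s4 : 4 / eps < s%:R by apply: truncnS_gt.
have s0 : 0 < s%:R :> R by rewrite ltr0n.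
pose p : R := (2 * expR 1) ^- s.
have p0 : 0 < p by rewrite invr_gt0 exprn_gt0// mulr_gt0// expR_gt0.
have [L L0 hL] := bulk_lln P eps0 p0.
pose c := (L + 2 * L * L)%N.
exists (2 * (Num.truncn (c%:R / eps)).+1 + 2 * c)%N => n nN D mD gD SD.
(* [K] strips of [m] blocks: each strip stays in the square, and there are at
   least [n] blocks, since [K * m] is close to [2 * n]. *)
pose K := (2 * L)%N; pose M := (n %/ L)%N; pose m := (M - K)%N.
have ML : (n < (M + 1) * L)%N by rewrite addn1; exact: ltn_ceil.
have ML' : (M * L <= n)%N by exact: leq_divM.
have KM : (K <= M)%N by rewrite /M /K leq_divRL//; move: nN; rewrite /c; lia.
have KML : (2 * L * L <= M * L)%N by rewrite leq_mul2r KM orbT.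
have mL : (n < m * L + c)%N.
  by rewrite /m /K mulnBl; move: KML ML; rewrite /c; lia.
have mK : (n <= K * m)%N.
  rewrite /m mulnBr [(K * M)%N](_ : _ = 2 * (M * L))%N; last by rewrite /K; lia.
  rewrite [(K * K)%N](_ : _ = 4 * (L * L))%N; last by rewrite /K; lia.
  by move: nN ML; rewrite /c; lia.
pose J := ('I_K * 'I_m)%type.
have cardJ : #|{: J}| = (K * m)%N by rewrite card_prod !card_ord.
pose E (j : J) : set T := [set t | block_time (om^~ t) L j.1 j.2 < (4 - eps) * L%:R].
have cn : 2 * c%:R <= eps * n%:R.
  have h1 : c%:R / eps < (Num.truncn (c%:R / eps)).+1%:R by apply: truncnS_gt.
  have h2 : (2 * (Num.truncn (c%:R / eps)).+1)%:R <= n%:R :> R by rewrite ler_nat; lia.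
  move: h1 h2; rewrite ltr_pdivrMr// natrM => h1 h2.
  have := ler_wpM2l (ltW eps0) h2; lra.
apply: (@le_trans _ _ (expR (- #|{: J}|%:R))%:E); last first.
  by rewrite lee_fin ler_expR lerN2 ler_nat cardJ.
apply: (many_rare_events (S := fun j : J => cell L j.1 j.2) (E := E) (s := s) eO) => //.
- move=> [k i] [k' i'] ij; rewrite -subset0 => z [[/= a1 a2 a3 a4] [/= b1 b2 b3 b4]].
  have ii : i = i' by apply: val_inj; exact: (interval_index a3 a4 b3 b4).
  have kk : k = k'.
    apply: val_inj; have := interval_index a1 a2 b1 b2; rewrite ii => /addnI. exact.
  by rewrite ii kk eqxx in ij.
- by move=> j; exact: block_sig.
- by move=> [k i]; exact: hL (translate_unit_field _).
- move=> t Dt; have [g gg ng] := gD t Dt; have St := SD t Dt.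
  have strip (k : 'I_K) : (m <= s * \sum_(i < m) `[< E (k, i) t >])%N.
    have := corner_geodesic_ge (k := k) (L := L) (m := m) (om := om^~ t) (fun z => O0 z t) _ gg ng.
    have mk : ((m + k) * L <= n)%N.
      apply: leq_trans ML'; rewrite leq_mul2r; apply/orP; right.
      by have := ltn_ord k; rewrite /m; lia.
    move=> /(_ mk) le; rewrite leqNgt; apply/negP => bad.
    pose b := (\sum_(i < m) `[< E (k, i) t >])%N.
    (* A block that is not slow contributes at least [(4 - eps) L]. *)
    have le' : (m%:R - b%:R) * ((4 - eps) * L%:R) <=
        \sum_(i < m) block_time (om^~ t) L k i.
      have -> : (m%:R - b%:R) * ((4 - eps) * L%:R) =
          \sum_(i < m) (1 - (nat_of_bool `[< E (k, i) t >])%:R) * ((4 - eps) * L%:R) :> R.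
        by rewrite -mulr_suml sumrB sumr_const card_ord -natr_sum.
      apply: ler_sum => i _; case: asboolP => [_|/negP].
        rewrite subrr mul0r; apply: lpp_ge0 => x y; rewrite /bulk; case: ifP => // _.
        exact: O0.
      by rewrite /E/= -leNgt subr0 mul1r.
    have bs : b%:R * s%:R <= m%:R :> R by rewrite -natrM ler_nat mulnC ltnW.
    have be : b%:R <= m%:R * (eps / 4) :> R.
      have b0 : 0 <= b%:R :> R by [].
      move: s4; rewrite ltr_pdivrMr// => s4.
      have := ler_wpM2l b0 (ltW s4); have := ler_wpM2r (ltW eps0) bs; lra.
    have mLr : n%:R <= m%:R * L%:R + c%:R :> R by rewrite -natrM -natrD ler_nat ltnW.
    have L0' : 0 <= L%:R :> R by [].
    have n0 : 0 <= n%:R :> R by [].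
    have x1 : (1 - eps / 4) * (m%:R * L%:R) <= (m%:R - b%:R) * L%:R.
      by have := ler_wpM2r L0' be; lra.
    have x2 : (1 - eps / 2) * n%:R <= m%:R * L%:R by lra.
    have e4 : 0 <= 1 - eps / 4 by lra.
    have x3 := le_trans (ler_wpM2l e4 x2) x1.
    have e5 : 0 <= 4 - eps by lra.
    have x4 := ler_wpM2l e5 x3.
    have e6 : 0 <= eps ^+ 2 * (5 / 4 - eps / 8) * n%:R.
      by rewrite mulr_ge0// mulr_ge0 ?sqr_ge0//; lra.
    by move: St le le' x4 e6; rewrite !expr2; lra.
  rewrite cardJ -(pair_bigA _ (fun k i => nat_of_bool `[< E (k, i) t >]))/=.
  rewrite big_distrr/= -[K in (K * _)%N]card_ord -sum_nat_const.
  by apply: leq_sum => k _; exact: strip.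
Qed.

End upper_bound.


Section corner_upper.
Context {d : measure_display} {T : measurableType d} {R : realType}.
Variable P : probability T R.
Variable om : site -> T -> R.
Hypothesis eO : expo_family P setT om (fun=> 1).

Lemma uniq_corner_sites n : uniq (corner_sites n).
Proof.
rewrite cat_uniq; apply/and3P; split.
- by rewrite map_inj_uniq ?iota_uniq// => i j []; lia.
- apply/hasPn => z /mapP[i _ ->]; apply/negP => /mapP[j _] []; lia.
- by rewrite map_inj_uniq ?iota_uniq// => i j []; lia.
Qed.

(** Either the corner path is heavy, which the Chernoff bound with parameter
    [1/2] controls with the exact rate, or [strips_unlikely] applies. *)
Lemma corner_upper (eps : R) : 0 < eps < 1 -> exists N : nat, forall n, (N <= n)%N ->
  forall D : set T, measurable D ->
  (forall t, D t -> exists2 g, is_geodesic (om^~ t) (0, 0) (n%:Z, n%:Z) g &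
     ((n%:Z, 0) : site) \in g) ->
  (P D <= (2 * expR (- ((2 - 2 * ln 2 - 2 * eps) * n%:R)))%:E)%E.
Proof.
move=> eps01; have [N hN] := strips_unlikely eO eps01; exists N => n nN D mD hD.
have [mO O0 _ _] := eO; have /andP[eps0 eps1] := eps01.
pose S t := \sum_(z <- corner_sites n) om z t.
have mS : measurable_fun setT S by exact: measurable_sumX.
pose A := [set t | (4 - 4 * eps) * n%:R <= S t].
pose B := D `&` [set t | S t < (4 - 4 * eps) * n%:R].
have mA : measurable A by exact: measurable_ge.
have mB : measurable B by apply: measurableI => //; exact: measurable_lt.
have DAB : D `<=` A `|` B.
  by move=> t Dt; have [h|h] := leP ((4 - 4 * eps) * n%:R) (S t); [left|right].
apply: (le_trans (le_measure P _ _ DAB)); rewrite ?inE//; first exact: measurableU.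
apply: (le_trans (measureU2 P mA mB)).
rewrite mulrDl mul1r EFinD; apply: leeD.
- have a0 : 0 <= (4 - 4 * eps) * n%:R by rewrite mulr_ge0//; lra.
  have h12 : 0 < (1 / 2 : R) <= 1 by lra.
  apply: (le_trans (erlang_ge eO (uniq_corner_sites n) (fun _ _ => I) h12 a0)).
  rewrite lee_fin size_cat !size_map !size_iota.
  have -> : (1 / 2 : R) ^- (n + n) = expR ((2 * n%:R) * ln 2).
    by rewrite -natrM [_ * ln 2]mulrC expRM_natr lnK ?posrE// div1r exprVn invrK mul2n addnn.
  rewrite -expRD ler_expR; lra.
- apply: (le_trans (hN n nN B mB _ _)).
  + by move=> t [Dt _]; exact: hD.
  + by move=> t [].
  + rewrite lee_fin ler_expR lerN2 ler_piMl//.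
    have := @half_le_ln2 R; lra.
Qed.

End corner_upper.


(** * The lower bound *)

Section corner_wins.
Context {R : realType}.
Implicit Types (om : site -> R) (n : nat).

(** Only complete blocks are controlled, so that an arbitrary prefix loses at
    most the [b] terms of its last block. *)
Lemma sum_blocks (f : nat -> R) (q b m : nat) : (forall k, 0 <= f k) ->
  (forall j, (j < q)%N -> 2 * b%:R <= \sum_(0 <= l < b) f (j * b + l)%N) ->
  (m <= q * b)%N ->
  2 * m%:R - 2 * b%:R <= \sum_(0 <= k < m) f k.
Proof.
move=> f0 hf mq.
have [b0|b0] := posnP b.
  by rewrite b0 muln0 leqn0 in mq; rewrite (eqP mq) b0 big_nil subrr.
have full j : (j <= q)%N -> 2 * (j * b)%:R <= \sum_(0 <= k < j * b) f k.
  elim: j => [|j ih] jq; first by rewrite mul0n big_nil mulr0.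
  rewrite (big_cat_nat _ (n := (j * b)%N)) ?leq_mul2r ?leqnSn ?orbT//=.
  rewrite mulSn addnC natrD mulrDr lerD//; first by apply: ih; exact: ltnW.
  rewrite -[X in \sum_(X <= _ < _) _]add0n big_addn addnC addnK.
  by under eq_bigr do rewrite addnC; exact: hf.
have jq : (m %/ b <= q)%N by rewrite -(mulnK q b0) leq_div2r.
rewrite (big_cat_nat _ (n := (m %/ b * b)%N)) ?leq_divM//=.
apply: (@le_trans _ _ (2 * (m %/ b * b)%:R)).
  rewrite -mulrBr ler_pM2l// lerBlDr -natrD ler_nat addnC -mulSn ltnW//.
  exact: ltn_ceil.
by rewrite -[leLHS]addr0 lerD ?full//; apply: sumr_ge0.
Qed.

(** The sites [(x, y)] with [0 <= x] and [0 < y] are made the bulk of a stationary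
    model. Paths in the square never visit the lines [x = -1] and [y = -1], whose
    weights serve as the axes of that model. *)
Definition aux_site (z : nat * nat) : site :=
  (z.1%:Z - 1, if z.2 == 0%N then -1 else z.2%:Z).

Lemma aux_siteS x y : aux_site (x.+1, y.+1) = (x%:Z, y.+1%:Z).
Proof. by congr (_, _) => /=; lia. Qed.

Definition aux_site_inv (z : site) : nat * nat :=
  (`|(z.1 + 1)%R|%N, if z.2 == -1 then 0%N else `|z.2|%N).

Lemma aux_siteK : cancel aux_site aux_site_inv.
Proof.
move=> [a b]; rewrite /aux_site /aux_site_inv/=; congr (_, _); first by lia.
by case: b.
Qed.

Definition aux_lpp om : nat -> nat -> R :=
  lpp (rescale 2^-1 2^-1 (fun a b => om (aux_site (a, b)))).

Lemma reach_corner om n : reach om (0, 0) (n%:Z, n%:Z)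
  (\sum_(z <- corner_sites n) om z).
Proof.
rewrite big_cat/= !big_map; apply: (@reach_trans _ _ _ (n%:Z, 0)).
  have h k : reach om (0, 0) (k%:Z, 0) (\sum_(j <- iota 0 k) om (j.+1%:Z, 0)).
    elim: k => [|k ih]; first by rewrite big_nil; exact: reach0.
    have -> : iota 0 k.+1 = iota 0 k ++ [:: k] by rewrite -addn1 iotaD.
    rewrite big_cat/= big_seq1; apply: reach_step ih.
    by apply/stepbP; left => /=; lia.
  exact: h.
have h k : reach om (n%:Z, 0) (n%:Z, k%:Z) (\sum_(j <- iota 0 k) om (n%:Z, j.+1%:Z)).
  elim: k => [|k ih]; first by rewrite big_nil; exact: reach0.
  have -> : iota 0 k.+1 = iota 0 k ++ [:: k] by rewrite -addn1 iotaD.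
  rewrite big_cat/= big_seq1; apply: reach_step ih.
  by apply/stepbP; right => /=; lia.
exact: h.
Qed.

(** A path that avoids the corner follows the bottom row, then the interior, then
    the right column. The potential is the sum of weights on the row, the
    stationary passage time [aux_lpp] in the interior, and the sum of weights on
    the column, with constants [C1] and [C2] that make it increase enough at the
    two changes. The hypotheses say that row and column sums grow at speed at
    least 2 and stationary increments at speed at most 2, up to the errors [B]
    and [e]; hence the total loss is less than the weight of the corner. *)
Lemma corner_wins om n (B e : R) g : (forall z, 0 <= om z) -> (0 < n)%N ->
  (forall m, (m < n)%N -> 2 * m%:R - 2 * B <=
     \sum_(0 <= k < m) om (n%:Z - 1 - k%:Z, 0)) ->
  (forall m, (m < n)%N -> 2 * m%:R - 2 * B <=
     \sum_(0 <= k < m) om (n%:Z, k.+1%:Z)) ->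
  (forall a, (a <= n)%N -> aux_lpp om n 0 - aux_lpp om a 0 <= 2 * (n - a)%:R + 2 * e) ->
  (forall j, (j <= n)%N -> aux_lpp om n j - aux_lpp om n 0 <= 2 * j%:R + 2 * e) ->
  4 * B + 4 * e + 2 < om (n%:Z, 0) ->
  is_geodesic om (0, 0) (n%:Z, n%:Z) g -> ((n%:Z, 0) : site) \in g.
Proof.
move=> om0 n0 hrow hcol hH hV hc [ug gmax]; apply: contraT => ng.
have [p [w lp ple]] := reach_corner om n.
have up : up_right_path (0, 0) (n%:Z, n%:Z) ((0, 0) :: p).
  by apply/up_right_pathP; exists p.
have := gmax _ up; rewrite passage_time_walk// => h.
have {h ple} Sg := le_trans ple h.
move: ug => /up_right_pathP [p' [gE w' lp']]; rewrite gE in Sg ng.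
rewrite passage_time_walk// in Sg.
pose H a := \sum_(0 <= i < a) om (i.+1%:Z, 0).
pose V b := \sum_(0 <= i < b) om (n%:Z, i.+1%:Z).
(* [C1] bounds [H x - aux_lpp om x.+1 0] for all [x < n]; this is enough
   because a step up from [(x, 0)] is paid by the first stationary increment in
   the column of that site. *)
pose C1 := H n.-1 - aux_lpp om n 0 + (2 * B + 2 * e).
pose C2 := H n.-1 + 4 * B + 4 * e + 2.
have SE : \sum_(z <- corner_sites n) om z = H n.-1 + om (n%:Z, 0) + V n.
  rewrite big_cat/= !big_map /H /V /index_iota !subn0; congr (_ + _).
  have -> : iota 0 n = iota 0 n.-1 ++ [:: n.-1].
    by rewrite -[in LHS](prednK n0) -addn1 iotaD.
  by rewrite big_cat/= big_seq1 prednK.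
have HB i : (i < n)%N -> 2 * (n.-1 - i)%:R - 2 * B <= H n.-1 - H i.
  move=> i_n; apply: (le_trans (hrow (n.-1 - i)%N _)); first by lia.
  have in1 : (i <= n.-1)%N by lia.
  rewrite /H (big_cat_nat _ in1)//= [X in _ <= X - _]addrC addrK.
  have -> : \sum_(i <= k < n.-1) om (k.+1%:Z, 0) =
      \sum_(0 <= k < n.-1 - i) om ((k + i).+1%:Z, 0).
    by rewrite -(big_addn 0 _ i predT (fun k => om (k.+1%:Z, 0))) add0n.
  rewrite [leRHS]big_nat_rev/= add0n.
  rewrite le_eqVlt; apply/orP; left; apply/eqP; apply: eq_big_nat => k /andP[_ kn].
  by congr (om (_, _)); lia.
pose Psi (z : site) := if z.2 == 0 then H `|z.1|%N else
  if z.1 == n%:Z then V `|z.2|%N + C2 else aux_lpp om (`|z.1|.+1)%N `|z.2|%N + C1.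
pose D (z : site) : Prop := [/\ 0 <= z.1 <= n%:Z, 0 <= z.2 <= n%:Z & z != (n%:Z, 0)].
have D0 : D (0, 0) by split => //=; rewrite xpair_eqE; lia.
have Dp z : z \in p' -> D z.
  move=> zp; have [/= z1 z2 z3 z4 _] := mem_walk w' zp; rewrite lp'/= in z3 z4.
  split; rewrite ?z1 ?z2//; apply/eqP => zE; rewrite zE in zp.
  by rewrite inE zp orbT in ng.
have := walk_potential (om := om) (Phi := Psi) (D := D) _ D0 Dp w'.
have -> : Psi (0, 0) = 0 by rewrite /Psi/= /H big_nil.
have -> : Psi (last (0, 0) p') = V n + C2.
  rewrite lp' /Psi/= eqxx; case: eqP => //; lia.
rewrite subr0 => fin.
suff : \sum_(z <- p') om z <= V n + C2 by rewrite /C2; move: Sg; rewrite SE; lra.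
have auxS1 x y : om (x%:Z, y.+1%:Z) + aux_lpp om x.+1 y <= aux_lpp om x.+1 y.+1.
  rewrite /aux_lpp lppSS /rescale /stationary_rate/= invr1 mul1r aux_siteS.
  by rewrite lerD2l le_max lexx orbT.
have auxS2 x y : om (x.+1%:Z, y.+1%:Z) + aux_lpp om x.+1 y.+1 <= aux_lpp om x.+2 y.+1.
  rewrite /aux_lpp [leRHS]lppSS /rescale /stationary_rate/= invr1 mul1r aux_siteS.
  by rewrite lerD2l le_max lexx.
have VS y : V y.+1 = V y + om (n%:Z, y.+1%:Z) by rewrite /V big_nat_recr.
have HS x : H x.+1 = H x + om (x.+1%:Z, 0) by rewrite /H big_nat_recr.
apply: fin => -[a b] [a' b'] [/= a0 b0 ab] [/= a0' b0' ab'] /stepbP/= st.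
have [x ax] : exists x : nat, a = x%:Z by exists `|a|%N; lia.
have [y by_] : exists y : nat, b = y%:Z by exists `|b|%N; lia.
subst a b; move: ab ab'; rewrite !xpair_eqE => ab ab'; rewrite /Psi.
case: st => -[ha hb]; subst a' b' => /=.
  rewrite (_ : x%:Z + 1 = x.+1%:Z) in a0' ab' *; last by lia.
  rewrite /= ?addn1 !eqz_nat; case: y b0 ab b0' ab' => [|y] b0 ab b0' ab' /=.
    by rewrite HS addrC addKr.
  have -> : (x == n) = false by lia.
  case: eqP => [xn|xn].
    rewrite -xn in hV *; rewrite xn VS.
    have := hV y.+1 _; rewrite xn => /(_ ltac:(lia)) h1.
    have := hcol y ltac:(lia); rewrite -/(V y) => h2.
    by rewrite /C2 /C1; move: h1 h2; rewrite -natr1; lra.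
  by have := auxS2 x y; lra.
rewrite (_ : y%:Z + 1 = y.+1%:Z) in b0' ab' *; last by lia.
rewrite /= ?addn1 !eqz_nat; case: eqP => [xn|xn].
  rewrite ifF; last by lia.
  by rewrite xn VS; lra.
case: eqP => [y0|_]; last by have := auxS1 x y; lra.
rewrite y0; have := auxS1 x 0%N.
have := HB x ltac:(lia); have := hH x.+1 ltac:(lia).
rewrite (_ : (n - x.+1)%N = (n.-1 - x)%N); last by lia.
by rewrite /C1; lra.
Qed.

End corner_wins.


Section lower_bound.
Context {d : measure_display} {T : measurableType d} {R : realType}.
Variable P : probability T R.

(** Only the last term of the truncated series is kept; it already carries the
    exponential rate. *)
Lemma erlang_block (b : nat) : (0 < b)%N ->
  expR (- (1 - ln 2) * b%:R) / (2 * expR 1 * b%:R) <=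
    expR (- (2 * b%:R)) * expsum b (2 * b%:R) :> R.
Proof.
case: b => // b _; rewrite expsumS.
have b0 : 0 < b.+1%:R :> R by rewrite ltr0n.
have e0 : 0 < expR 1 :> R by exact: expR_gt0.
have x0 : 0 <= 2 * b.+1%:R :> R by rewrite mulr_ge0// ltW.
apply: (@le_trans _ _ (expR (- (2 * b.+1%:R)) * ((2 * b.+1%:R) ^+ b / b`!%:R))); last first.
  by rewrite ler_wpM2l ?expR_ge0// lerDr expsum_ge0.
have -> : (2 * b.+1%:R) ^+ b / b`!%:R = (2 * b.+1%:R) ^+ b.+1 / 2 / (b.+1)`!%:R :> R.
  rewrite factS natrM exprS; field.
  by rewrite pnatr_eq0 -lt0n fact_gt0/= -natr1 in b0 *; lra.
have -> : expR (- (1 - ln 2) * b.+1%:R) =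
    expR (- (2 * b.+1%:R)) * (2 ^+ b.+1 * expR 1 ^+ b.+1) :> R.
  rewrite -[in 2 ^+ _](@lnK _ 2) ?posrE// -!expRM_natr -!expRD; congr expR.
  by rewrite /=; ring.
rewrite -mulrA ler_wpM2l ?expR_ge0//.
rewrite -[leRHS]mulrA exprMn -!mulrA ler_wpM2l ?exprn_ge0//.
rewrite ler_pdivrMr; last by rewrite !mulr_gt0.
have f0 : 0 < (b.+1)`!%:R :> R by rewrite ltr0n fact_gt0.
have := @fact_le R b; rewrite expr_div_n => fl.
have E0 : 0 < expR 1 ^+ b.+1 :> R by rewrite exprn_gt0.
have B0 : 0 < b.+1%:R ^+ b.+1 :> R by rewrite exprn_gt0.
rewrite [leRHS]mulrA ler_pdivlMr// in fl.
rewrite [leRHS](_ : _ = expR 1 * b.+1%:R * b.+1%:R ^+ b.+1 / (b.+1)`!%:R); last first.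
  by field; rewrite gt_eqF.
by rewrite ler_pdivlMr// mulrC.
Qed.

Lemma row_increment_erlang (X : nat * nat -> T -> R) n a : unit_field P X ->
  (a <= n)%N -> erlang_sum P (n - a) (fun t => lpp (field X t) n 0 - lpp (field X t) a 0).
Proof.
move=> eX an.
exists (nat * nat)%type, [set z | z != (0, 0)%N], X, [seq (i, 0%N) | i <- iota a.+1 (n - a)].
split => //.
- by rewrite map_inj_uniq ?iota_uniq// => i j [].
- by move=> z /mapP[i]; rewrite mem_iota => + ->; rewrite /= xpair_eqE; lia.
- by rewrite size_map size_iota.
- move=> t; rewrite big_map -{1}(subnKC an).
  elim: (n - a)%N => [|m ih]; first by rewrite addn0 subrr big_nil.
  have -> : iota a.+1 m.+1 = iota a.+1 m ++ [:: (a + m).+1].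
    by rewrite -[m.+1 in LHS]addn1 iotaD addSn.
  by rewrite big_cat/= -ih big_seq1 addnS lppS0 addrAC.
Qed.

Variable om : site -> T -> R.
Hypothesis eO : expo_family P setT om (fun=> 1).

Lemma aux_unit_field : unit_field P (fun z => om (aux_site z)).
Proof. by apply: (expo_family_reindex (A := setT) aux_siteK eO). Qed.

Let w t := field (fun z => om (aux_site z)) t.

(** The indices up to [n] stand for the increments along the row axis of the
    stationary model, the following ones for those along its column [n]. *)
Definition bulk_excess n (e : R) (i : nat) : set T :=
  if (i <= n)%N then
    [set t | (n - i)%:R + e <= lpp (w t) n 0 - lpp (w t) i 0]
  else [set t | (i - n.+1)%:R + e <=
    2^-1 * (aux_lpp (om^~ t) n (i - n.+1) - aux_lpp (om^~ t) n 0)].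

Definition bulk_calm n (e : R) : set T :=
  ~` \big[setU/set0]_(i < 2 * n.+1) bulk_excess n e i.

Definition aux_region n : set site := [set z | z.1 < n%:Z /\ z.2 != 0].

Lemma bulk_excess_sig n e i : sig om (aux_region n) (bulk_excess n e i).
Proof.
have mom a b : (a <= n)%N ->
   measurable_fun (setT : set (g_sigma_algebraType (gens om (aux_region n))))
     (om (aux_site (a, b))).
  by move=> an; apply: sig_measurable_fun; split => /=; [lia|case: b].
have ml x y : (x <= n)%N ->
    measurable_fun (setT : set (g_sigma_algebraType (gens om (aux_region n))))
     (fun t => lpp (w t) x y).
  move=> xn; apply: (@measurable_lpp R _ (g_sigma_algebraType (gens om (aux_region n)))
    (fun z t => om (aux_site z) t)).
  by move=> a b ax _ _; apply: mom; exact: leq_trans xn.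
rewrite /bulk_excess; case: ifP => i_n.
  by apply: sig_ge; apply: measurable_funB; apply: ml.
apply: sig_ge; apply: measurable_funM; first exact: measurable_cst.
apply: measurable_funB;
  apply: (@measurable_lpp R _ (g_sigma_algebraType (gens om (aux_region n)))
    (fun z t => (stationary_rate 2^-1 2^-1 z)^-1 * om (aux_site z) t));
  by move=> a b ax _ _; apply: measurable_funM; [exact: measurable_cst|apply: mom].
Qed.

Lemma bulk_calm_sig n e : sig om (aux_region n) (bulk_calm n e).
Proof.
apply: (@measurableC _ (g_sigma_algebraType (gens om (aux_region n)))).
apply: (@bigsetU_measurable _ (g_sigma_algebraType (gens om (aux_region n)))).
by move=> i _; exact: bulk_excess_sig.
Qed.

Lemma bulk_calm_ge n (q : R) : 1 <= q ->
  (1 - (2 * n.+1)%:R * expR (- (n%:R / (8 * q ^+ 2))) <= fine (P (bulk_calm n (n%:R / q)))).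
Proof.
move=> q1; have q0 : 0 < q by lra.
have [mO _ _ _] := eO.
have mE i : measurable (bulk_excess n (n%:R / q) i).
  exact: (sig_measurable mO (@bulk_excess_sig n (n%:R / q) i)).
have mU : measurable (\big[setU/set0]_(i < 2 * n.+1) bulk_excess n (n%:R / q) i).
  exact: bigsetU_measurable.
rewrite /bulk_calm probability_setC// fineB// ?fin_num_measure//=.
rewrite lerD2l lerN2 -lee_fin fineK ?fin_num_measure//.
apply: (union_bound mU) => [i _|i i2|//]; first exact: mE.
pose u : R := (4 * q)^-1.
have u01 : 0 <= u <= 1 / 2.
  have q4 : 0 < 4 * q by rewrite mulr_gt0.
  have u2 : u <= 2^-1 by rewrite /u lef_pV2 ?posrE//; lra.
  have u0 : 0 < u by rewrite /u invr_gt0.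
  lra.
have nq0 : 0 <= n%:R / q by rewrite divr_ge0// ltW.
have key m f : (m <= n)%N -> erlang_sum P m f ->
    (P [set t | (m%:R + n%:R / q <= f t)%R] <= (expR (- (n%:R / (8 * q ^+ 2))))%:E)%E.
  move=> mn ef; apply: (le_trans (erlang_sum_ge_exp ef u01 _)).
    by rewrite addr_ge0.
  rewrite lee_fin ler_expR.
  have -> : - (n%:R / (8 * q ^+ 2)) = 2 * u ^+ 2 * n%:R - u * (n%:R / q).
    by rewrite /u; field; rewrite gt_eqF.
  have : 0 <= 2 * u ^+ 2 * (n%:R - m%:R).
    apply: mulr_ge0; first by rewrite mulr_ge0 ?sqr_ge0.
    by rewrite subr_ge0 ler_nat.
  by rewrite !expr2; lra.
have h2 : (0 : R) < 2^-1 by lra.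
rewrite /bulk_excess; case: leqP => i_n.
  apply: key; first exact: leq_subr.
  exact: row_increment_erlang aux_unit_field i_n.
apply: key; first by lia.
have := vertical_erlang aux_unit_field n (i - n.+1) h2 h2.
by apply; lra.
exact: subset_refl.
Qed.

End lower_bound.


Section corner_lower.
Context {d : measure_display} {T : measurableType d} {R : realType}.
Variable P : probability T R.
Variable om : site -> T -> R.
Hypothesis eO : expo_family P setT om (fun=> 1).

Definition block_site n b (c : bool) j l : site :=
  if c then (n%:Z - 1 - (j * b + l)%N%:Z, 0) else (n%:Z, (j * b + l).+1%:Z).

Definition block_sites n b c j : seq site := [seq block_site n b c j l | l <- iota 0 b].

(** [None] labels the interior, [Some None] the corner site, and
    [Some (Some (c, j))] the block [j] of the bottom row, if [c], or of the right
    column; [good_event] is the event prescribed on each region. *)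
Definition event_region n b (k : option (option (bool * nat))) : set site :=
  match k with
  | None => aux_region n
  | Some None => [set (n%:Z, 0)]
  | Some (Some (c, j)) => [set z | exists2 l, (l < b)%N & z = block_site n b c j l]
  end.

Definition good_event n b (e C : R) (k : option (option (bool * nat))) : set T :=
  match k with
  | None => bulk_calm om n e
  | Some None => [set t | C <= om (n%:Z, 0) t]
  | Some (Some (c, j)) => [set t | 2 * b%:R <= \sum_(z <- block_sites n b c j) om z t]
  end.

Lemma event_region_disjoint n b k k' : (0 < n)%N -> k != k' ->
  event_region n b k `&` event_region n b k' = set0.
Proof.
move=> n0 kk; rewrite -subset0 => z [].
have blk j l j' l' : (l < b)%N -> (l' < b)%N -> (j * b + l = j' * b + l')%N -> j = j'.
  move=> lb lb' h; have b0 : (0 < b)%N by lia.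
  have := congr1 (fun m => m %/ b)%N h.
  by rewrite !divnMDl// !divn_small// !addn0.
case: k k' kk => [[[c j]|]|] [[[c' j']|]|] //=.
- move=> cj [l lb ->] [l' lb' e].
  have e1 := congr1 fst e; have e2 := congr1 snd e.
  have : c = c' by case: c c' {cj e} e1 e2 => [] [] //=; lia.
  move=> cc; subst c'; have jj : j = j'.
    by apply: (blk _ l _ l' lb lb'); case: c {cj e} e1 e2 => /=; lia.
  by rewrite jj eqxx in cj.
- by move=> _ [l lb ->] e; have := congr1 fst e; have := congr1 snd e; case: c {e} => /=; lia.
- by move=> _ [l lb ->]; rewrite /aux_region; case: c => -[/= e1 e2]; lia.
- by move=> _ -> [l lb] e; have := congr1 fst e; have := congr1 snd e; case: c' {e} => /=; lia.
- by move=> _ -> [/= e1 e2]; lia.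
- by move=> _ [/= e1 e2] [l lb zE]; move: e1 e2; rewrite zE; case: c' {zE} => /= e1 e2; lia.
- by move=> _ [e1 e2] zE; move: e1 e2; rewrite zE /=; lia.
Qed.

Lemma block_sites_uniq n b c j : uniq (block_sites n b c j).
Proof.
rewrite map_inj_uniq ?iota_uniq// => l l'.
by case: c => -[]; lia.
Qed.

Lemma good_event_sig n b e C k : sig om (event_region n b k) (good_event n b e C k).
Proof.
case: k => [[[c j]|]|] /=.
- apply: sig_ge.
  apply: sig_measurable_sum => z /mapP[l]; rewrite mem_iota => /andP[_ lb] ->.
  by exists l.
- by apply: sig_tail.
- exact: bulk_calm_sig.
Qed.

Lemma block_event_ge n b e C c j : (0 < b)%N ->
  ((expR (- (1 - ln 2) * b%:R) / (2 * expR 1 * b%:R))%:E <=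
    P (good_event n b e C (Some (Some (c, j)))))%E.
Proof.
move=> b0; rewrite /good_event (@erlang_tail _ _ _ P _ setT om)//.
- by rewrite lee_fin size_map size_iota; exact: erlang_block.
- exact: block_sites_uniq.
- by rewrite mulr_gt0// ltr0n.
Qed.

Definition event_labels q : seq (option (option (bool * nat))) :=
  None :: Some None ::
    [seq Some (Some cj) | cj <- [seq (c, j) | c <- [:: true; false], j <- iota 0 q]].

Lemma event_labels_uniq q : uniq (event_labels q).
Proof.
rewrite /event_labels /= inE/=.
have u : uniq [seq Some (Some cj) | cj <- [seq (c, j) | c <- [:: true; false], j <- iota 0 q]].
  rewrite map_inj_uniq => [|x y [] //].
  by apply: allpairs_uniq; [|exact: iota_uniq|move=> [? ?] [? ?] _ _ /= [-> ->]].
rewrite u andbT; apply/andP; split; apply/mapP => -[cj _] //.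
Qed.

Lemma good_events_ge n b q e C : (0 < n)%N -> (0 < b)%N -> 0 <= C ->
  ((fine (P (bulk_calm om n e)) * expR (- C) *
     (expR (- (1 - ln 2) * b%:R) / (2 * expR 1 * b%:R)) ^+ (2 * q))%:E <=
   P (\big[setI/setT]_(k <- event_labels q) good_event n b e C k))%E.
Proof.
move=> n0 b0 C0; have [mO O0 _ _] := eO.
rewrite (@sig_indep_seq _ _ _ P _ _ om setT (fun=> 1) (event_region n b) _
  (event_labels q))//; first last.
- by move=> k; exact: good_event_sig.
- by move=> i j; exact: event_region_disjoint.
- exact: event_labels_uniq.
rewrite /event_labels 2!big_cons muleA EFinM.
have beta0 : 0 <= expR (- (1 - ln 2) * b%:R) / (2 * expR 1 * b%:R) :> R.
  by rewrite divr_ge0 ?expR_ge0// !mulr_ge0// expR_ge0.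
apply: lee_pmul.
- by rewrite lee_fin mulr_ge0 ?expR_ge0// fine_ge0.
- by rewrite lee_fin exprn_ge0.
- rewrite EFinM fineK; last first.
    by rewrite fin_num_measure//; exact: (sig_measurable mO (@bulk_calm_sig _ _ _ om n e)).
  apply: lee_pmul => //; rewrite ?lee_fin ?expR_ge0//=.
  by rewrite (expo_family1 eO)// mul1r.
- have -> : (2 * q)%N = size [seq (c, j) | c <- [:: true; false], j <- iota 0 q].
    by rewrite size_allpairs size_iota.
  rewrite big_map; elim: [seq _ | _ <- _, _ <- _] => [|[c j] l ih].
    by rewrite big_nil.
  rewrite big_cons/= exprS EFinM; apply: lee_pmul => //; rewrite ?lee_fin ?exprn_ge0//.
  exact: block_event_ge.
Qed.

Lemma good_events_win n b q (C : R) t g : (0 < n)%N -> (n <= q * b)%N -> 0 < C ->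
  4 * b%:R + 4 * (n%:R / q%:R) + 2 < C ->
  (\big[setI/setT]_(k <- event_labels q) good_event n b (n%:R / q%:R) C k) t ->
  is_geodesic (om^~ t) (0, 0) (n%:Z, n%:Z) g -> ((n%:Z, 0) : site) \in g.
Proof.
move=> n0 nqb C0 hC Et gg; have [mO O0 _ _] := eO.
have Ek k : k \in event_labels q -> good_event n b (n%:R / q%:R) C k t.
  by move: Et; rewrite -bigcap_seq => Et kq; exact: Et.
have Eb : good_event n b (n%:R / q%:R) C None t by apply: Ek; rewrite inE.
have Ec : good_event n b (n%:R / q%:R) C (Some None) t by apply: Ek; rewrite !inE.
have Ebl c j : (j < q)%N -> 2 * b%:R <= \sum_(0 <= l < b) om (block_site n b c j l) t.
  move=> jq; have : good_event n b (n%:R / q%:R) C (Some (Some (c, j))) t.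
    apply: Ek; rewrite !inE; apply/orP; right; apply/orP; right.
    apply: map_f; apply/allpairsP; exists (c, j); rewrite mem_iota/= jq.
    by split => //; case: c.
  by rewrite /= big_map /index_iota subn0.
have calm i : (i < 2 * n.+1)%N -> ~ bulk_excess om n (n%:R / q%:R) i t.
  by move=> i2 h; apply: Eb; rewrite -bigcup_mkord; exists i.
apply: (@corner_wins R (om^~ t) n b%:R (n%:R / q%:R) g) => //.
- move=> m mn; apply: (@sum_blocks _ (fun k => om (n%:Z - 1 - k%:Z, 0) t) q b) => //.
    by move=> j /(Ebl true).
  by apply: leq_trans nqb; exact: ltnW.
- move=> m mn; apply: (@sum_blocks _ (fun k => om (n%:Z, k.+1%:Z) t) q b) => //.
    by move=> j /(Ebl false).
  by apply: leq_trans nqb; exact: ltnW.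
- move=> a an; have := calm a _; rewrite /bulk_excess an => /(_ ltac:(lia))/negP.
  rewrite -ltNge /aux_lpp !lpp_rescale_row invrK /field; lra.
- move=> j jn; have := calm (n.+1 + j)%N _; rewrite /bulk_excess ifF; last by lia.
  by rewrite addKn => /(_ ltac:(lia))/negP; rewrite -ltNge; lra.
- exact: lt_le_trans Ec.
Qed.

(** The cost of the blocks is [2 q b (1 - ln 2)] with [q b <= n + q]. The corner
    weight costs [4 b + 4 n / q + 3], of order [8 n / q], and the polynomial
    prefactors of the blocks at most [2 b] up to a constant, of order [2 n / q];
    the interior is calm with probability at least [1/2]. *)
Lemma corner_lower (q : nat) : (0 < q)%N -> exists (K : R) (N : nat), forall n,
  (0 < n)%N -> (N <= n)%N -> exists E : set T, [/\ measurable E,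
    ((expR (- ((2 - 2 * ln 2) * n%:R + 10 * (n%:R / q%:R) + K)))%:E <= P E)%E &
    forall t, E t -> forall g, is_geodesic (om^~ t) (0, 0) (n%:Z, n%:Z) g ->
      ((n%:Z, 0) : site) \in g].
Proof.
move=> q0; have [mO O0 _ _] := eO.
have q0r : 0 < q%:R :> R by rewrite ltr0n.
have q1r : 1 <= q%:R :> R by rewrite ler1n.
pose c : R := (8 * q%:R ^+ 2)^-1.
have q2 : 0 < 8 * q%:R ^+ 2 :> R by rewrite mulr_gt0// exprn_gt0.
have c0 : 0 < c by rewrite invr_gt0.
have c1 : c <= 1.
  by rewrite invf_le1//; have := exprn_ege1 2 q1r; lra.
have [N hN] := @expR_small R (c / 2) (c / 8) ltac:(lra) ltac:(lra).
(* What remains when [b] is bounded by [n / q + 1]; the last term comes from the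
   prefactors [1 / (2 e b)], through [b <= q exp (b / q)]. *)
pose K : R := ln 2 + 9 + 2 * (1 - ln 2) * q%:R + 2 * q%:R * ln (2 * expR 1 * q%:R).
exists K, N => n n0 nN.
pose b := (n %/ q).+1.
pose C : R := 4 * b%:R + 4 * (n%:R / q%:R) + 3.
exists (\big[setI/setT]_(k <- event_labels q) good_event n b (n%:R / q%:R) C k).
have nqb : (n <= q * b)%N by rewrite mulnC ltnW// ltn_ceil.
have nq0 : 0 <= n%:R / q%:R :> R by rewrite divr_ge0// ltW.
have C0 : 0 < C by rewrite /C; have := ler0n R b; lra.
split; first last.
- by move=> t Et g; apply: (good_events_win (C := C) n0 nqb C0 _ Et); rewrite /C; lra.
- apply: le_trans (good_events_ge _ _ n0 (ltn0Sn _) (ltW C0)).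
  have calm : 2^-1 <= fine (P (bulk_calm om n (n%:R / q%:R))).
    apply: le_trans (bulk_calm_ge eO n q1r).
    (* The decay [x * x] beats the factor [n + 1]: one [x] absorbs it. *)
    set x := expR (- (c / 2 * n%:R)).
    have xc : x <= c / 8 by exact: hN.
    have x0 : 0 < x by exact: expR_gt0.
    have -> : expR (- (n%:R / (8 * q%:R ^+ 2))) = x * x.
      by rewrite /x -expRD -/c; congr expR; lra.
    have nx : c / 2 * (n%:R + 1) * x <= 1.
      rewrite -[leRHS](mulVf (lt0r_neq0 x0)) ler_wpM2r ?(ltW x0)// /x expRN invrK.
      by apply: le_trans (expR_ge1Dx _); lra.
    rewrite lerBrDr -lerBrDl natrM.
    have := ler_wpM2r (ltW x0) nx => nx'.
    have : c * (2 * (n%:R + 1) * (x * x)) <= c * (1 - 2^-1) by lra.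
    by rewrite ler_pM2l// -natr1; lra.
  have l1 : ln 2 <= 1 :> R.
    rewrite -ler_expR lnK ?posrE//; have := @expR_ge1Dx R 1; lra.
  have br : b%:R <= n%:R / q%:R + 1 :> R.
    by rewrite /b -natr1 lerD2r ler_pdivlMr// -natrM ler_nat leq_divM.
  have qb : q%:R * b%:R <= n%:R + q%:R :> R.
    have := ler_wpM2l (ltW q0r) br; rewrite mulrDr mulr1 mulrCA divff ?mulr1//.
    by rewrite gt_eqF.
  have e1 : 0 < 2 * expR 1 :> R by rewrite mulr_gt0// expR_gt0.
  have b0 : 0 < b%:R :> R by rewrite ltr0n.
  have hb : expR (- (1 - ln 2) * b%:R - b%:R / q%:R - ln (2 * expR 1 * q%:R)) <=
      expR (- (1 - ln 2) * b%:R) / (2 * expR 1 * b%:R) :> R.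
    rewrite -addrA expRD ler_wpM2l ?expR_ge0// -opprD expRN.
    rewrite lef_pV2 ?posrE ?expR_gt0 ?mulr_gt0// expRD lnK ?posrE ?mulr_gt0//.
    rewrite [leRHS]mulrCA ler_pM2l// -ler_pdivrMr//.
    by apply: le_trans (expR_ge1Dx _); lra.
  rewrite lee_fin.
  apply: (@le_trans _ _ (expR (- ln 2) * expR (- C) *
     expR (- (1 - ln 2) * b%:R - b%:R / q%:R - ln (2 * expR 1 * q%:R)) ^+ (2 * q))).
    rewrite -expRM_natr -!expRD ler_expR natrM /K /C.
    have -> : (- (1 - ln 2) * b%:R - b%:R / q%:R - ln (2 * expR 1 * q%:R)) * (2 * q%:R) =
       - (2 * (1 - ln 2) * (q%:R * b%:R)) - 2 * b%:R - 2 * q%:R * ln (2 * expR 1 * q%:R) :> R.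
      by field; rewrite gt_eqF.
    have l0 : 0 <= 2 * (1 - ln 2) :> R by lra.
    have := ler_wpM2l l0 qb; lra.
  apply: ler_pM; rewrite ?mulr_ge0 ?exprn_ge0 ?expR_ge0//.
    rewrite ler_wpM2r ?expR_ge0//; apply: le_trans calm.
    by rewrite expRN lnK ?posrE.
  by apply: lerXn2r => //; rewrite nnegrE ?expR_ge0// (le_trans _ hb)// expR_ge0.
- by apply: bigsetI_measurable => k _; exact: (sig_measurable mO (@good_event_sig n b _ C k)).
Qed.

End corner_lower.


(** * From the weights to the limit *)

Section environment.
Context {d : measure_display} {T : measurableType d} {R : realType}.
Variable P : probability T R.

Lemma iid_exponential_ge (I : choiceType) (X : I -> {RV P >-> R}) i x :
  iid_exponential 1 X -> 0 <= x -> P (X i @^-1` `[x, +oo[) = (expR (- x))%:E.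
Proof.
move=> [_ lawX] x0; have := lawX i `[x, +oo[%classic (measurable_itv _).
by rewrite expo_tail// mul1r.
Qed.

(** Exponential weights are nonnegative almost surely only; taking the positive
    part changes no tail event at a positive threshold. *)
Lemma iid_exponential_family (I : choiceType) (X : I -> {RV P >-> R}) :
  iid_exponential 1 X ->
  expo_family P setT (fun i t => Num.max (X i t) 0) (fun=> 1).
Proof.
move=> iidX; have [indX _] := iidX; split => //.
- by move=> i; apply: measurable_maxr => //; exact: measurable_cst.
- by move=> i t; rewrite le_max lexx orbT.
move=> s x us _ x0.
pose B i : set R := if 0 < x i then `[x i, +oo[%classic else setT.
have mB i : measurable (B i) by rewrite /B; case: ifP => _ //; exact: measurable_itv.
have -> : tails (fun i t => Num.max (X i t) 0) s x =
    \big[setI/setT]_(i <- s) (X i @^-1` B i).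
  rewrite -bigcap_seq; apply/seteqP; split => t h i si.
    rewrite /= /B; case: ifPn => // xi0.
    by have := h i si; rewrite /= in_itv/= andbT le_max [x i <= 0]leNgt xi0 orbF.
  have := h i si; rewrite /= /B le_max; case: ifPn; rewrite -?leNgt => xi0.
    by rewrite /= in_itv/= andbT => ->.
  by rewrite xi0 orbT.
rewrite (indX s B us mB) -sumrN expR_sum -prodEFin; apply: eq_bigr => i _.
rewrite mul1r /B; case: ifPn => xi0; first by rewrite (iid_exponential_ge _ iidX)// ltW.
have -> : x i = 0 by apply/eqP; rewrite eq_le x0 leNgt xi0.
by rewrite preimage_setT probability_setT oppr0 expR0.
Qed.

Lemma iid_exponential_ae_ge0 (I : countType) (X : I -> {RV P >-> R}) :
  iid_exponential 1 X -> {ae P, forall t, forall i, 0 <= X i t}.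
Proof.
move=> iidX.
have : {ae P, forall t, forall n : nat, forall i, unpickle n = Some i -> 0 <= X i t}.
  apply: ae_foralln => n; case: (unpickle n) => [j|]; last exact: aeW.
  have mj : measurable (X j @^-1` `[0, +oo[).
    by rewrite -[X in measurable X]setTI; apply: measurable_funP => //; exact: measurable_itv.
  exists (~` (X j @^-1` `[0, +oo[)); split; first exact: measurableC.
    apply: (etrans (probability_setC P mj)).
    by rewrite (iid_exponential_ge _ iidX)// oppr0 expR0 subee.
  by move=> t /= h h'; apply: h => i [<-]; move: h'; rewrite in_itv/= andbT.
apply: filterS => t h i; exact: (h (pickle i) i (pickleK i)).
Qed.

End environment.


(** Logarithms turn the two bounds into [c - 2 eps - o(1)] and
    [c + 10 / q + o(1)]. *)
Lemma log_rate_cvg (R : realType) (c : R) (p : nat -> R) :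
  (forall eps : R, 0 < eps < 1 -> exists N : nat, forall n, (N <= n)%N ->
     p n <= 2 * expR (- ((c - 2 * eps) * n%:R))) ->
  (forall q, (0 < q)%N -> exists (K : R) (N : nat), forall n, (0 < n)%N -> (N <= n)%N ->
     expR (- (c * n%:R + 10 * (n%:R / q%:R) + K)) <= p n) ->
  - (n%:R^-1 * ln (p n)) @[n --> \oo] --> c.
Proof.
move=> up lo; apply/cvgrPdist_le => e e0.
pose eps := Num.min (e / 4) (1 / 2).
have eps01 : 0 < eps < 1.
  rewrite lt_min gt_min; apply/andP; split; [apply/andP; split|]; first by lra.
    by lra.
  by apply/orP; right; lra.
have epse : eps <= e / 4 by rewrite ge_min lexx.
have [N1 h1] := up _ eps01.
pose q := (Num.truncn (20 / e)).+1.
have q0 : 0 < q%:R :> R by rewrite ltr0n.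
have q20 : 20 < e * q%:R by rewrite mulrC -ltr_pdivrMr//; exact: truncnS_gt.
have [K [N2 h2]] := lo q (ltn0Sn _).
pose M := Num.max (ln 2) K.
pose N3 := (Num.truncn (2 * M / e)).+1.
exists (maxn N1 (maxn N2 N3)) => // n /=; rewrite !geq_max => /andP[n1 /andP[n2 n3]].
have n0 : (0 < n)%N by exact: leq_trans n3.
have n0r : 0 < n%:R :> R by rewrite ltr0n.
have nM : M <= e / 2 * n%:R.
  have : 2 * M / e < n%:R by apply: (lt_le_trans (truncnS_gt _)); rewrite ler_nat.
  rewrite ltr_pdivrMr//; lra.
have [M1 M2] : ln 2 <= M /\ K <= M by rewrite !le_max !lexx orbT.
have p0 : 0 < p n by apply: lt_le_trans (h2 n n0 n2); exact: expR_gt0.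
have Lu : ln (p n) <= ln 2 - (c - 2 * eps) * n%:R.
  rewrite -ler_expR lnK ?posrE// expRD lnK ?posrE//; exact: h1.
have Ll : - (c * n%:R + 10 * (n%:R / q%:R) + K) <= ln (p n).
  by rewrite -ler_expR lnK ?posrE//; exact: h2.
have nq : 10 * (n%:R / q%:R) <= e / 2 * n%:R.
  rewrite mulrA ler_pdivrMr//.
  have := ler_wpM2l (ltW n0r) (ltW q20); lra.
have ne : eps * n%:R <= e / 4 * n%:R by rewrite ler_pM2r.
rewrite opprK -(ler_pM2r n0r) -[X in _ * X](ger0_norm (ltW n0r)) -normrM mulrDl.
rewrite mulrAC mulVf ?gt_eqF// mul1r ler_norml; apply/andP; split; lra.
Qed.

Lemma measurable_countable_preimage d (T : measurableType d) (I : countType)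
    (f : T -> I) (A : pred I) : (forall i, measurable [set t | f t = i]) ->
  measurable [set t | A (f t)].
Proof.
move=> mf.
have -> : [set t | A (f t)] = \bigcup_k (if unpickle k is Some i then
    if A i then [set t | f t = i] else set0 else set0).
  apply/seteqP; split => t /=.
    by move=> h; exists (pickle (f t)) => //; rewrite pickleK h.
  by move=> [k _]; case: (unpickle k) => [i|//]; case: ifP => // h /= ->.
by apply: bigcup_measurable => k _; case: (unpickle k) => [i|//]; case: ifP.
Qed.

Section corner_event.
Context {d : measure_display} {T : measurableType d} {R : realType}.
Variables (P : probability T R) (omega : site -> {RV P >-> R}).
Variable (Gamma : nat -> T -> seq site).
Hypothesis iid : iid_exponential 1 omega.
Hypothesis geo : forall n, geodesic_version omega (0, 0) (n%:Z, n%:Z) (Gamma n).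

Let om z t := Num.max (omega z t) 0.
Let corner n : set T := [set w | ((n%:Z, 0) : site) \in Gamma n w].

Lemma measurable_corner n : measurable (corner n).
Proof.
have [mG _] := geo n.
exact: (measurable_countable_preimage (I := seq (int * int)%type)
  (fun g => ((n%:Z, 0) : site) \in (g : seq site)) mG).
Qed.

(** The given path is a geodesic for the weights [om], outside of a measurable null
    set: both the almost sure maximality and the almost sure nonnegativity of all
    weights enter. *)
Lemma clipped_geodesic n : exists N, [/\ measurable N, P N = 0 &
  forall t, ~ N t -> is_geodesic (om^~ t) (0, 0) (n%:Z, n%:Z) (Gamma n t)].
Proof.
have h : {ae P, forall t, is_geodesic (om^~ t) (0, 0) (n%:Z, n%:Z) (Gamma n t)}.
  have [_ aen] := geo n; apply: filterS2 (iid_exponential_ae_ge0 iid) aen => t t0.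
  congr is_geodesic; apply/funext => z; by rewrite /om max_l.
have [N [mN N0 hN]] := h; exists N; split => // t Nt; apply: contrapT => g.
exact/Nt/hN.
Qed.

Lemma corner_prob_le (eps : R) : 0 < eps < 1 -> exists N : nat, forall n, (N <= n)%N ->
  fine (P (corner n)) <= 2 * expR (- ((2 - 2 * ln 2 - 2 * eps) * n%:R)).
Proof.
move=> eps01; have [N hN] := corner_upper (iid_exponential_family iid) eps01.
exists N => n nN; have [Z [mZ PZ hZ]] := clipped_geodesic n.
have mC := measurable_corner n.
have mD : measurable (corner n `\` Z) by exact: measurableD.
rewrite -lee_fin fineK ?fin_num_measure//.
apply: le_trans (hN n nN _ mD _); last by move=> t [Ct Zt]; exists (Gamma n t) => //; exact: hZ.
rewrite -[leRHS]adde0 -PZ; apply: le_trans (measureU2 P mD mZ).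
apply: le_measure; rewrite ?inE//; first exact: measurableU.
by move=> t Ct; have [Zt|Zt] := pselect (Z t); [right|left].
Qed.

Lemma corner_prob_ge q : (0 < q)%N -> exists (K : R) (N : nat), forall n,
  (0 < n)%N -> (N <= n)%N ->
  expR (- ((2 - 2 * ln 2) * n%:R + 10 * (n%:R / q%:R) + K)) <= fine (P (corner n)).
Proof.
move=> q0; have [K [N hN]] := corner_lower (iid_exponential_family iid) q0.
exists K, N => n n0 nN; have [E [mE PE hE]] := hN n n0 nN.
have [Z [mZ PZ hZ]] := clipped_geodesic n.
have mC := measurable_corner n.
rewrite -lee_fin fineK ?fin_num_measure//; apply: (le_trans PE).
rewrite -[leRHS]adde0 -PZ; apply: le_trans (measureU2 P mC mZ).
apply: le_measure; rewrite ?inE//; first exact: measurableU.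
move=> t Et; have [Zt|Zt] := pselect (Z t); [by right|left].
exact: (hE t Et _ (hZ t Zt)).
Qed.

End corner_event.

Theorem corollary1p3 (d : measure_display) (T : measurableType d) (R : realType)
    (P : probability T R) (omega : site -> {RV P >-> R})
    (Gamma : nat -> T -> seq site) :
  iid_exponential 1 omega ->
  (forall n : nat, geodesic_version omega (0, 0) (n%:Z, n%:Z) (Gamma n)) ->
  (- ((n%:R : R)^-1 * ln (fine (P [set w | ((n%:Z, 0) : site) \in Gamma n w]))))
     @[n --> within [set n : nat | ~~ odd n] \oo] --> (2 - 2 * ln 2 : R).
Proof.
move=> iid geo; apply: cvg_within_filter; apply: log_rate_cvg.
- exact: (corner_prob_le iid geo).
- exact: (corner_prob_ge iid geo).
Qed.
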